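(* Let $\mathcal{G}$ be an ultragraph, let $R$ be a unital commutative ring, and let $L_R(\mathcal{G})$ be the Leavitt path algebra of $\mathcal{G}$. Let $\mathbb{F}$ be the free group generated by $\mathcal{G}^1$ (with neutral element written $0$), and let $\beta=(\{\beta_t\}_{t\in\mathbb{F}},\{D_t\}_{t\in\mathbb{F}})$ be the partial action of $\mathbb{F}$ on the $R$-algebra $D$ described in the context. Then there exists an $R$-algebra isomorphism $\phi:L_R(\mathcal{G})\to D\rtimes_\beta\mathbb{F}$ such that $\phi(p_A)=1_A\delta_0$, $\phi(s_e^* )=1_{e^{-1}}\delta_{e^{-1}}$ and $\phi(s_e)=1_e\delta_e$ for each $A\in\mathcal{G}^0$ and each $e\in\mathcal{G}^1$.
   Context: **Ultragraphs.** An ultragraph $\mathcal{G}=(G^0,\mathcal{G}^1,r,s)$ consists of two countable sets $G^0$ (vertices) and $\mathcal{G}^1$ (edges), a map $s:\mathcal{G}^1\to G^0$ and a map $r:\mathcal{G}^1\to P(G^0)\setminus\{\emptyset\}$, where $P(G^0)$ is the power set. $\mathcal{G}^0$ denotes the smallest subset of $P(G^0)$ that contains $\{v\}$ for all $v\in G^0$, contains $r(e)$ for all $e\in\mathcal{G}^1$, and is closed under finite unions and non-empty finite intersections (so all elements of $\mathcal{G}^0$ are non-empty). A vertex $v$ is identified with $\{v\}$ in subscripts, e.g. $p_v=p_{\{v\}}$. **Leavitt path algebra.** $L_R(\mathcal{G})$ is the universal (associative, not necessarily unital) $R$-algebra with generators $\{s_e,s_e^*:e\in\mathcal{G}^1\}\cup\{p_A:A\in\mathcal{G}^0\}$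 and relations: (1) $p_\emptyset=0$ (convention for empty intersections), $p_Ap_B=p_{A\cap B}$, $p_{A\cup B}=p_A+p_B-p_{A\cap B}$ for $A,B\in\mathcal{G}^0$; (2) $p_{s(e)}s_e=s_ep_{r(e)}=s_e$ and $p_{r(e)}s_e^*=s_e^*p_{s(e)}=s_e^*$ for $e\in\mathcal{G}^1$; (3) $s_e^*s_f=\delta_{e,f}\,p_{r(e)}$ for $e,f\in\mathcal{G}^1$; (4) $p_v=\sum_{s(e)=v}s_es_e^*$ whenever $0<|s^{-1}(v)|<\infty$. **The set $X$.** A vertex $v$ is a sink if $s^{-1}(v)=\emptyset$; $G^0_s$ is the set of sinks. A path of positive finite length $n\ge1$ is a sequence of edges $e_1\dots e_n$ with $s(e_{i+1})\in r(e_i)$ for $1\le i\le n-1$; an infinite path is a sequence $e_1e_2\dots$ with $s(e_{i+1})\in r(e_i)$ for all $i\geq 1$. For a finite path $\alpha=e_1\dots e_n$, $|\alpha|=n$, $s(\alpha)=s(e_1)$, $r(\alpha)=r(e_n)$; for an infinite path $s(e_1e_2\dots)=s(e_1)$. Let $\mathfrak{p}^\infty$ be the set of infinite paths and $$X=\mathfrak{p}^\infty\cup\{(\alpha,v):\alpha\text{ a finite path},|\alpha|\ge1,\ v\in G^0_s\cap r(\alpha)\}\cup\{(v,v):v\in G^0_s\}.$$ For $x=(\alpha,v)$: $s(x)=s(\alpha)$, $|x|=|\alpha|$, and $x_i$ is the $i$-th edge of $\alpha$; $s(v,v)=v$, $|(v,v)|=0$. **The sets $X_c$.** Let $W\subseteq\mathbb{F}$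 be the set of elements $a_1\dots a_n$ ($n\ge1$) that are paths of positive finite length. Define: - for $a\in W$: $X_a=\{x\in X:x_1\dots x_{|a|}=a\}$; - for $b\in W$: $X_{b^{-1}}=\{x\in X:s(x)\in r(b)\}$; - for $a,b\in W$ with $ab^{-1}$ reduced (last edges of $a$ and $b$ distinct) and $r(a)\cap r(b)\ne\emptyset$: $X_{ab^{-1}}=\{x\in X:|x|>|a|,\ x_1\dots x_{|a|}=a,\ s(x_{|a|+1})\in r(a)\cap r(b)\}\cup\{(a,v)\in X:v\in r(a)\cap r(b)\}$; - $X_0=X$; and $X_c=\emptyset$ for all other $c\in\mathbb{F}$. For $A\in\mathcal{G}^0$ and $b\in W$: $X_A=\{x\in X:s(x)\in A\}$ and $X_{bA}=\{x\in X_b:|x|>|b|,\ s(x_{|b|+1})\in A\}\cup\{(b,v)\in X_b:v\in A\}$. **The bijections $\theta_c$.** For $a\in W$, $\theta_a:X_{a^{-1}}\to X_a$ is $\theta_a(x)=ax$ if $|x|=\infty$, $\theta_a(\alpha,v)=(a\alpha,v)$, $\theta_a(v,v)=(a,v)$; $\theta_{a^{-1}}=\theta_a^{-1}$. For $a,b\in W$ with $ab^{-1}$ reduced (last edges of $a$ and $b$ distinct) and $r(a)\cap r(b)\ne\emptyset$, $\theta_{ab^{-1}}:X_{ba^{-1}}\to X_{ab^{-1}}$ replaces the initial segment $b$ by $a$: $by\mapsto ay$, $(b\alpha,v)\mapsto(a\alpha,v)$, $(b,v)\mapsto(a,v)$. $\theta_0=\mathrm{id}_X$, and $\theta_c$ is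 the empty map for all other $c$. **The partial action $\beta$.** Write $1_A,1_{bA},1_c$ for the $R$-valued characteristic functions on $X$ of $X_A,X_{bA},X_c$. Let $D$ be the $R$-algebra (pointwise operations) of functions $X\to R$ generated by (equivalently, the $R$-linear span of) $\{1_A,1_{bA},1_c:A\in\mathcal{G}^0,b\in W,c\in\mathbb{F}\setminus\{0\}\}$. Put $D_0=D$ and, for $t\neq0$, let $D_t$ be the $R$-span of $\{1_t1_A,1_t1_{bA},1_t1_c:A\in\mathcal{G}^0,b\in W,c\in\mathbb{F}\}$, an ideal of $D$. For $t\in\mathbb{F}$, $\beta_t:D_{t^{-1}}\to D_t$ is $\beta_t(f)=f\circ\theta_{t^{-1}}$ on $X_t$, and $0$ off $X_t$. This gives a partial action of $\mathbb{F}$ on $D$. **Partial skew group ring.** $D\rtimes_\beta\mathbb{F}$ is the set of finite formal sums $\sum_t a_t\delta_t$ with $a_t\in D_t$, with componentwise addition and multiplication determined by $(a_t\delta_t)(b_s\delta_s)=\beta_t(\beta_{t^{-1}}(a_t)b_s)\delta_{ts}$. *)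

(* Defs.v *)
From HB Require Import structures.
From mathcomp Require Import all_boot all_order all_algebra.
From mathcomp Require Import boolp classical_sets functions cardinality fsbigop.
From mathcomp Require Import numfun.

Set Implicit Arguments.
Unset Strict Implicit.
Unset Printing Implicit Defensive.

Import GRing.Theory.

Local Open Scope classical_set_scope.
Local Open Scope ring_scope.

(* Associative, not necessarily unital, algebras: the algebras of [ssralg] all
   have a unit. *)
HB.mixin Record Lmodule_isNUAlgebra (R : pzRingType) A of GRing.Lmodule R A := {
  nmul : A -> A -> A;
  nmulA : associative nmul;
  nmulDl : left_distributive nmul +%R;
  nmulDr : right_distributive nmul +%R;
  scale_nmulAl : forall (k : R) (x y : A), k *: nmul x y = nmul (k *: x) y;
  scale_nmulAr : forall (k : R) (x y : A), k *: nmul x y = nmul x (k *: y)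
}.

#[short(type="nuAlgType")]
HB.structure Definition NUAlgebra (R : pzRingType) :=
  { A of Lmodule_isNUAlgebra R A & GRing.Lmodule R A }.

Notation "x ** y" := (nmul x y) (at level 40, left associativity) : ring_scope.

(* The free group on [T], as the set of reduced words; [(x, true)] stands for
   the inverse of the generator [x]. *)
Section FreeGroup.
Variable T : choiceType.
Implicit Types (l : T * bool) (u v w : seq (T * bool)).

Definition letter_inv l := (l.1, ~~ l.2).

Definition reduced w := sorted (fun l l' => l' != letter_inv l) w.

Record freegroup := FreeGroup { fgval : seq (T * bool); _ : reduced fgval }.

HB.instance Definition _ := [isSub for fgval].
HB.instance Definition _ := [Choice of freegroup by <:].

Definition cons_red l w :=
  if w is l' :: w' then if l' == letter_inv l then w' else l :: w else [:: l].

Definition cat_red u v := foldr cons_red v u.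

Lemma letter_invK : involutive letter_inv.
Proof. by case=> x b; rewrite /letter_inv /= negbK. Qed.

Lemma cons_red_reduced l w : reduced w -> reduced (cons_red l w).
Proof.
case: w => [|l' w] //= rw; case: eqP => [_|/eqP ne]; first exact: path_sorted rw.
by rewrite /reduced /= ne.
Qed.

Lemma cat_red_reduced u v : reduced v -> reduced (cat_red u v).
Proof. by move=> rv; elim: u => //= l u IHu; apply: cons_red_reduced. Qed.

Lemma cons_redK l w : reduced w -> cons_red (letter_inv l) (cons_red l w) = w.
Proof.
case: w => [|l' w] /=; first by rewrite letter_invK eqxx.
case: eqP => [->|_] /= rw; last by rewrite letter_invK eqxx.
by case: w rw => [|l'' w] //= /andP[/negbTE ->].
Qed.

Lemma cat_red_cons l u v : reduced v ->
  cat_red (cons_red l u) v = cons_red l (cat_red u v).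
Proof.
move=> rv; case: u => [|l' u] //=; case: eqP => [->|_] //=.
by rewrite -{1}(letter_invK l) cons_redK //; apply: cat_red_reduced.
Qed.

Lemma cat_redA u v w : reduced w ->
  cat_red u (cat_red v w) = cat_red (cat_red u v) w.
Proof. by move=> rw; elim: u => //= l u ->; rewrite cat_red_cons. Qed.

Lemma cat_reds0 u : reduced u -> cat_red u [::] = u.
Proof.
elim: u => //= l u IHu ru; rewrite IHu; last exact: path_sorted ru.
by case: u ru {IHu} => //= l' u /andP[/negbTE -> _].
Qed.

Lemma cat_redVs u : cat_red (rev (map letter_inv u)) u = [::].
Proof.
elim: u => //= l u IHu.
by rewrite rev_cons /cat_red foldr_rcons /= letter_invK eqxx.
Qed.

Lemma inv_reduced u : reduced u -> reduced (rev (map letter_inv u)).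
Proof.
rewrite /reduced rev_sorted sorted_map; apply: sub_sorted => l l' /=.
by apply: contraNN => /eqP E; rewrite E letter_invK.
Qed.

Definition fg_one := @FreeGroup [::] isT.
Definition fg_mul (x y : freegroup) : freegroup :=
  FreeGroup (cat_red_reduced (fgval x) (valP y)).
Definition fg_inv (x : freegroup) : freegroup :=
  FreeGroup (inv_reduced (valP x)).

Lemma fg_mulA : associative fg_mul.
Proof. by move=> x y [w rw]; apply: val_inj; apply: cat_redA. Qed.

Lemma fg_mul1x : left_id fg_one fg_mul.
Proof. by move=> x; apply: val_inj. Qed.

Lemma fg_mulx1 : right_id fg_one fg_mul.
Proof. by move=> [w rw]; apply: val_inj; apply: cat_reds0. Qed.

Lemma fg_mulVx : left_inverse fg_one fg_inv fg_mul.
Proof. by move=> x; apply: val_inj; apply: cat_redVs. Qed.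

Lemma fg_mulxV : right_inverse fg_one fg_inv fg_mul.
Proof.
move=> x; apply: val_inj => /=.
rewrite -[X in cat_red X _](mapK letter_invK) -[map _ _ in X in cat_red X _]revK.
by rewrite -map_rev cat_redVs.
Qed.

HB.instance Definition _ := isGroup.Build freegroup
  fg_mulA fg_mul1x fg_mulx1 fg_mulVx fg_mulxV.

Definition fg_gen (x : T) : freegroup := @FreeGroup [:: (x, false)] isT.

Definition fg_word (s : seq T) : freegroup := \big[*%g/1%g]_(x <- s) fg_gen x.

End FreeGroup.

Record ultragraph := Ultragraph {
  vertex : countType;
  edge : countType;
  src : edge -> vertex;
  rng : edge -> set vertex;
  rng_neq0 : forall e, rng e !=set0
}.

Section UltragraphSets.
Variable G : ultragraph.
Local Notation V := (vertex G).
Local Notation E := (edge G).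

Definition gvset : set (set V) := smallest
  [set M | (forall A B, M A -> M B -> M (A `|` B)) /\
           (forall A B, M A -> M B -> A `&` B !=set0 -> M (A `&` B))]
  ([set [set v] | v in [set: V]] `|` [set rng e | e in [set: E]]).

Lemma gvset_neq0 A : gvset A -> A !=set0.
Proof.
apply: (_ : smallest _ _ `<=` [set A | A !=set0]); apply: smallest_sub => /=.
  by split=> [B C [v Bv] _|//]; exists v; left.
by move=> _ [[v _ <-]|[e _ <-]]; [exists v | apply: rng_neq0].
Qed.

(* Extension of a family indexed by [gvset] to all sets of vertices, with
   default value [z].  It is only ever used at members of [gvset] and at the
   empty set, which is not in [gvset]; with [z = 0] it encodes the convention
   that the projection attached to the empty set is 0. *)
Definition extend (B : Type) (z : B) (p : gvset -> B) (A : set V) : B :=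
  oapp p z (insub A).

End UltragraphSets.

Arguments gvset : clear implicits.

(* The relations of a Leavitt path algebra, in an arbitrary algebra. *)
Record leavitt_family (R : comPzRingType) (G : ultragraph) (B : nuAlgType R)
    (p : gvset G -> B) (s s' : edge G -> B) : Prop := LeavittFamily {
  lf_pI : forall A A', gvset G A -> gvset G A' ->
    extend 0 p A ** extend 0 p A' = extend 0 p (A `&` A');
  lf_pU : forall A A', gvset G A -> gvset G A' ->
    extend 0 p (A `|` A') =
    extend 0 p A + extend 0 p A' - extend 0 p (A `&` A');
  lf_src_s : forall e, extend 0 p [set src e] ** s e = s e;
  lf_s_rng : forall e, s e ** extend 0 p (rng e) = s e;
  lf_rng_s' : forall e, extend 0 p (rng e) ** s' e = s' e;
  lf_s'_src : forall e, s' e ** extend 0 p [set src e] = s' e;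
  lf_s's_eq : forall e, s' e ** s e = extend 0 p (rng e);
  lf_s's_neq : forall e f, e != f -> s' e ** s f = 0;
  lf_ck : forall v (l : seq (edge G)), uniq l -> l != [::] ->
    (forall e, (e \in l) = (src e == v)) ->
    extend 0 p [set v] = \sum_(e <- l) s e ** s' e
}.

(* The Leavitt path algebra: formal expressions in the generators, modulo the
   smallest congruence containing the algebra axioms and the relations above. *)
Section LeavittPathAlgebra.
Variables (R : comPzRingType) (G : ultragraph).
Local Notation V := (vertex G).
Local Notation E := (edge G).

Inductive lterm : Type :=
| LP of gvset G
| LS of E
| LS' of E
| L0
| LAdd of lterm & lterm
| LOpp of lterm
| LScale of R & lterm
| LMul of lterm & lterm.

Local Notation P := (extend L0 LP).

Inductive lcong : lterm -> lterm -> Prop :=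
| lc_refl x : lcong x x
| lc_sym x y : lcong x y -> lcong y x
| lc_trans x y z : lcong x y -> lcong y z -> lcong x z
| lc_add x x' y y' : lcong x x' -> lcong y y' -> lcong (LAdd x y) (LAdd x' y')
| lc_opp x x' : lcong x x' -> lcong (LOpp x) (LOpp x')
| lc_scale k x x' : lcong x x' -> lcong (LScale k x) (LScale k x')
| lc_mul x x' y y' : lcong x x' -> lcong y y' -> lcong (LMul x y) (LMul x' y')
| lc_addA x y z : lcong (LAdd x (LAdd y z)) (LAdd (LAdd x y) z)
| lc_addC x y : lcong (LAdd x y) (LAdd y x)
| lc_add0 x : lcong (LAdd L0 x) x
| lc_addN x : lcong (LAdd (LOpp x) x) L0
| lc_scaleA k l x : lcong (LScale k (LScale l x)) (LScale (k * l) x)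
| lc_scale1 x : lcong (LScale 1 x) x
| lc_scaleDr k x y : lcong (LScale k (LAdd x y)) (LAdd (LScale k x) (LScale k y))
| lc_scaleDl k l x : lcong (LScale (k + l) x) (LAdd (LScale k x) (LScale l x))
| lc_mulA x y z : lcong (LMul x (LMul y z)) (LMul (LMul x y) z)
| lc_mulDl x y z : lcong (LMul (LAdd x y) z) (LAdd (LMul x z) (LMul y z))
| lc_mulDr x y z : lcong (LMul x (LAdd y z)) (LAdd (LMul x y) (LMul x z))
| lc_scaleAl k x y : lcong (LScale k (LMul x y)) (LMul (LScale k x) y)
| lc_scaleAr k x y : lcong (LScale k (LMul x y)) (LMul x (LScale k y))
| lc_pI A A' : gvset G A -> gvset G A' ->
    lcong (LMul (P A) (P A')) (P (A `&` A'))
| lc_pU A A' : gvset G A -> gvset G A' ->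
    lcong (P (A `|` A')) (LAdd (LAdd (P A) (P A')) (LOpp (P (A `&` A'))))
| lc_src_s e : lcong (LMul (P [set src e]) (LS e)) (LS e)
| lc_s_rng e : lcong (LMul (LS e) (P (rng e))) (LS e)
| lc_rng_s' e : lcong (LMul (P (rng e)) (LS' e)) (LS' e)
| lc_s'_src e : lcong (LMul (LS' e) (P [set src e])) (LS' e)
| lc_s's_eq e : lcong (LMul (LS' e) (LS e)) (P (rng e))
| lc_s's_neq e f : e != f -> lcong (LMul (LS' e) (LS f)) L0
| lc_ck v (l : seq E) : uniq l -> l != [::] ->
    (forall e, (e \in l) = (src e == v)) ->
    lcong (P [set v]) (\big[LAdd/L0]_(e <- l) LMul (LS e) (LS' e)).

HB.instance Definition _ := gen_eqMixin lterm.
HB.instance Definition _ := gen_choiceMixin lterm.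

Definition lcongb : rel lterm := fun x y => `[< lcong x y >].

Lemma lcongb_refl : reflexive lcongb.
Proof. by move=> x; apply/asboolP/lc_refl. Qed.

Lemma lcongb_sym : symmetric lcongb.
Proof. by move=> x y; apply/asboolP/asboolP; apply: lc_sym. Qed.

Lemma lcongb_trans : transitive lcongb.
Proof.
by move=> y x z /asboolP xy /asboolP yz; apply/asboolP; apply: lc_trans xy yz.
Qed.

Canonical lcongb_equiv := EquivRel lcongb lcongb_refl lcongb_sym lcongb_trans.

Definition leavitt : Type := {eq_quot lcongb}%qT.
HB.instance Definition _ := Choice.on leavitt.
HB.instance Definition _ := EqQuotient.on leavitt.

Definition lclass (t : lterm) : leavitt := (\pi_leavitt t)%qT.

Lemma lclassP t u : lclass t = lclass u <-> lcong t u.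
Proof.
split=> [/eqP|tu]; first by rewrite /lclass eqmodE => /asboolP.
by apply/eqP; rewrite /lclass eqmodE; apply/asboolP.
Qed.

Lemma lcong_repr t : lcong (repr (lclass t)) t.
Proof. by apply/lclassP; rewrite /lclass reprK. Qed.

Definition lv_zero : leavitt := lclass L0.
Definition lv_add (x y : leavitt) : leavitt := lclass (LAdd (repr x) (repr y)).
Definition lv_opp (x : leavitt) : leavitt := lclass (LOpp (repr x)).
Definition lv_scale (k : R) (x : leavitt) : leavitt :=
  lclass (LScale k (repr x)).
Definition lv_mul (x y : leavitt) : leavitt := lclass (LMul (repr x) (repr y)).

Lemma lclass_ind (Q : leavitt -> Prop) :
  (forall t, Q (lclass t)) -> forall x, Q x.
Proof. by move=> Qt x; rewrite -[x]reprK; apply: Qt. Qed.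

Lemma lclass_add t u : lv_add (lclass t) (lclass u) = lclass (LAdd t u).
Proof. by apply/lclassP/lc_add; apply: lcong_repr. Qed.

Lemma lclass_opp t : lv_opp (lclass t) = lclass (LOpp t).
Proof. by apply/lclassP/lc_opp/lcong_repr. Qed.

Lemma lclass_scale k t : lv_scale k (lclass t) = lclass (LScale k t).
Proof. by apply/lclassP/lc_scale/lcong_repr. Qed.

Lemma lclass_mul t u : lv_mul (lclass t) (lclass u) = lclass (LMul t u).
Proof. by apply/lclassP/lc_mul; apply: lcong_repr. Qed.

Lemma lv_addA : associative lv_add.
Proof.
elim/lclass_ind=> x; elim/lclass_ind=> y; elim/lclass_ind=> z.
by rewrite !lclass_add; apply/lclassP/lc_addA.
Qed.

Lemma lv_addC : commutative lv_add.
Proof.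
elim/lclass_ind=> x; elim/lclass_ind=> y.
by rewrite !lclass_add; apply/lclassP/lc_addC.
Qed.

Lemma lv_add0 : left_id lv_zero lv_add.
Proof. by elim/lclass_ind=> x; rewrite lclass_add; apply/lclassP/lc_add0. Qed.

Lemma lv_addN : left_inverse lv_zero lv_opp lv_add.
Proof.
by elim/lclass_ind=> x; rewrite lclass_opp lclass_add; apply/lclassP/lc_addN.
Qed.

HB.instance Definition _ := GRing.isZmodule.Build leavitt
  lv_addA lv_addC lv_add0 lv_addN.

Lemma lv_scaleA k l x : lv_scale k (lv_scale l x) = lv_scale (k * l) x.
Proof.
by elim/lclass_ind: x => x; rewrite !lclass_scale; apply/lclassP/lc_scaleA.
Qed.

Lemma lv_scale1 : left_id 1 lv_scale.
Proof.
by elim/lclass_ind=> x; rewrite lclass_scale; apply/lclassP/lc_scale1.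
Qed.

Lemma lv_scaleDr : right_distributive lv_scale +%R.
Proof.
move=> k; elim/lclass_ind=> x; elim/lclass_ind=> y.
rewrite [X in lv_scale _ X]lclass_add !lclass_scale [RHS]lclass_add.
exact/lclassP/lc_scaleDr.
Qed.

Lemma lv_scaleDl x : {morph lv_scale^~ x : k l / k + l}.
Proof.
elim/lclass_ind: x => x k l; rewrite !lclass_scale [RHS]lclass_add.
exact/lclassP/lc_scaleDl.
Qed.

HB.instance Definition _ := GRing.Zmodule_isLmodule.Build R leavitt
  lv_scaleA lv_scale1 lv_scaleDr lv_scaleDl.

Lemma lv_mulA : associative lv_mul.
Proof.
elim/lclass_ind=> x; elim/lclass_ind=> y; elim/lclass_ind=> z.
by rewrite !lclass_mul; apply/lclassP/lc_mulA.
Qed.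

Lemma lv_mulDl : left_distributive lv_mul +%R.
Proof.
elim/lclass_ind=> x; elim/lclass_ind=> y; elim/lclass_ind=> z.
rewrite [X in lv_mul X _]lclass_add !lclass_mul [RHS]lclass_add.
exact/lclassP/lc_mulDl.
Qed.

Lemma lv_mulDr : right_distributive lv_mul +%R.
Proof.
elim/lclass_ind=> x; elim/lclass_ind=> y; elim/lclass_ind=> z.
rewrite [X in lv_mul _ X]lclass_add !lclass_mul [RHS]lclass_add.
exact/lclassP/lc_mulDr.
Qed.

Lemma lv_scaleAl (k : R) (x y : leavitt) :
  k *: lv_mul x y = lv_mul (k *: x) y.
Proof.
elim/lclass_ind: x => x; elim/lclass_ind: y => y.
rewrite lclass_mul [LHS]lclass_scale [X in lv_mul X _]lclass_scale lclass_mul.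
exact/lclassP/lc_scaleAl.
Qed.

Lemma lv_scaleAr (k : R) (x y : leavitt) :
  k *: lv_mul x y = lv_mul x (k *: y).
Proof.
elim/lclass_ind: x => x; elim/lclass_ind: y => y.
rewrite lclass_mul [LHS]lclass_scale [X in lv_mul _ X]lclass_scale lclass_mul.
exact/lclassP/lc_scaleAr.
Qed.

HB.instance Definition _ := Lmodule_isNUAlgebra.Build R leavitt
  lv_mulA lv_mulDl lv_mulDr lv_scaleAl lv_scaleAr.

Definition lpa_p (A : gvset G) : leavitt := lclass (LP A).
Definition lpa_s (e : E) : leavitt := lclass (LS e).
Definition lpa_s' (e : E) : leavitt := lclass (LS' e).

Lemma lclass0 : lclass L0 = 0. Proof. by []. Qed.

Lemma lclassD t u : lclass (LAdd t u) = lclass t + lclass u.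
Proof. exact/esym/lclass_add. Qed.

Lemma lclassN t : lclass (LOpp t) = - lclass t.
Proof. exact/esym/lclass_opp. Qed.

Lemma lclassZ k t : lclass (LScale k t) = k *: lclass t.
Proof. exact/esym/lclass_scale. Qed.

Lemma lclassM t u : lclass (LMul t u) = lclass t ** lclass u.
Proof. exact/esym/lclass_mul. Qed.

Lemma extend_lpa A : extend 0 lpa_p A = lclass (P A).
Proof. by rewrite /extend; case: insubP. Qed.

Lemma lpa_family : leavitt_family lpa_p lpa_s lpa_s'.
Proof.
have PE : extend 0 lpa_p = lclass \o P by apply/funext => A; apply: extend_lpa.
split; rewrite ?PE /=.
- by move=> *; rewrite -lclassM; apply/lclassP; constructor.
- move=> A A' gA gA'; rewrite -lclassN -(lclassD (P A)) -[RHS]lclassD.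
  by apply/lclassP; constructor.
- by move=> *; rewrite -lclassM; apply/lclassP; constructor.
- by move=> *; rewrite -lclassM; apply/lclassP; constructor.
- by move=> *; rewrite -lclassM; apply/lclassP; constructor.
- by move=> *; rewrite -lclassM; apply/lclassP; constructor.
- by move=> *; rewrite -lclassM; apply/lclassP; constructor.
- by move=> *; rewrite -lclassM; apply/lclassP; constructor.
- move=> v l ul l0 lv; under eq_bigr do rewrite -lclassM.
  rewrite -(big_morph lclass lclassD lclass0).
  by apply/lclassP; constructor.
Qed.

Section Universality.
Variables (B : nuAlgType R) (p : gvset G -> B) (s s' : E -> B).
Hypothesis fam : leavitt_family p s s'.

Fixpoint leval (t : lterm) : B :=
  match t with
  | LP A => p A
  | LS e => s e
  | LS' e => s' e
  | L0 => 0
  | LAdd t u => leval t + leval u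
  | LOpp t => - leval t
  | LScale k t => k *: leval t
  | LMul t u => leval t ** leval u
  end.

Lemma leval_extend A : leval (P A) = extend 0 p A.
Proof. by rewrite /extend; case: insubP. Qed.

Lemma leval_cong t u : lcong t u -> leval t = leval u.
Proof.
case: fam => pI pU ss sr rs' s's s's_eq s's_neq ck.
elim=> /=; rewrite ?leval_extend //.
- by move=> x y z _ -> _ ->.
- by move=> x x' y y' _ -> _ ->.
- by move=> x x' _ ->.
- by move=> k x x' _ ->.
- by move=> x x' y y' _ -> _ ->.
- by move=> *; apply: addrA.
- by move=> *; apply: addrC.
- by move=> *; apply: add0r.
- by move=> *; apply: addNr.
- by move=> *; apply: scalerA.
- by move=> *; apply: scale1r.
- by move=> *; apply: scalerDr.
- by move=> *; apply: scalerDl.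
- by move=> *; apply: nmulA.
- by move=> *; apply: nmulDl.
- by move=> *; apply: nmulDr.
- by move=> *; apply: scale_nmulAl.
- by move=> *; apply: scale_nmulAr.
- by move=> A A' /= gA gA'; rewrite !leval_extend pI.
- by move=> A A' gA gA'; rewrite !leval_extend pU.
- by move=> e; rewrite leval_extend.
- by move=> e; rewrite leval_extend.
- by move=> e; rewrite leval_extend.
- by move=> e; rewrite leval_extend.
- by move=> e; rewrite leval_extend.
- move=> v l ul l0 lv; rewrite leval_extend (ck v l) //.
  by rewrite (big_morph leval (id1 := 0) (op1 := +%R)).
Qed.

Definition leavitt_lift (x : leavitt) : B := leval (repr x).

Lemma leavitt_liftE t : leavitt_lift (lclass t) = leval t.
Proof. exact/leval_cong/lcong_repr. Qed.

Lemma leavitt_lift_linear : linear leavitt_lift.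
Proof.
move=> k; elim/lclass_ind=> x; elim/lclass_ind=> y.
by rewrite -lclassZ -lclassD !leavitt_liftE.
Qed.

Lemma leavitt_lift_mul : {morph leavitt_lift : x y / x ** y}.
Proof.
elim/lclass_ind=> x; elim/lclass_ind=> y.
by rewrite -lclassM !leavitt_liftE.
Qed.

Lemma leavitt_lift_unique (f : {linear leavitt -> B}) :
  {morph f : x y / x ** y} -> (forall A, f (lpa_p A) = p A) ->
  (forall e, f (lpa_s e) = s e) -> (forall e, f (lpa_s' e) = s' e) ->
  f =1 leavitt_lift.
Proof.
move=> fM fp fs fs'; elim/lclass_ind=> t; rewrite leavitt_liftE.
elim: t => //=.
- by rewrite lclass0 linear0.
- by move=> t IHt u IHu; rewrite lclassD linearD IHt IHu.
- by move=> t IHt; rewrite lclassN linearN IHt.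
- by move=> k t IHt; rewrite lclassZ linearZ_LR IHt.
- by move=> t IHt u IHu; rewrite lclassM fM IHt IHu.
Qed.

End Universality.
End LeavittPathAlgebra.

Arguments leavitt : clear implicits.
Arguments lpa_p : clear implicits.
Arguments lpa_s : clear implicits.
Arguments lpa_s' : clear implicits.

Section Paths.
Variable G : ultragraph.
Local Notation V := (vertex G).
Local Notation E := (edge G).

Definition sink (v : V) : Prop := forall e : E, src e != v.

Definition follows (e f : E) : bool := src f \in rng e.

(* Paths of positive finite length, as words in the edges. *)
Definition fpath : set (seq E) := [set a | a != [::] /\ sorted follows a].

Definition last_edge (a : seq E) : option E := ohead (rev a).

Definition path_rng (a : seq E) : set V :=
  if last_edge a is Some e then rng e else set0.

(* [UInf p] is the infinite sequence of edges [p 0], [p 1], ...; [UFin a v] is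
   the pair [(a, v)], and [UFin [::] v] is the pair [(v, v)]. *)
Inductive upath : Type :=
| UInf of (nat -> E)
| UFin of seq E & V.

HB.instance Definition _ := gen_eqMixin upath.
HB.instance Definition _ := gen_choiceMixin upath.

Definition boundary : set upath := [set x |
  match x with
  | UInf p => forall i, follows (p i) (p i.+1)
  | UFin a v => sink v /\ (a = [::] \/ (fpath a /\ path_rng a v))
  end].

Local Notation X := (set_type boundary).

Definition usrc (x : upath) : V :=
  match x with
  | UInf p => src (p 0%N)
  | UFin a v => if a is e :: _ then src e else v
  end.

(* The first [n] edges (all of them if there are fewer), and the edge number
   [n], counting from 0. *)
Definition utake (n : nat) (x : upath) : seq E :=
  match x with UInf p => mkseq p n | UFin a _ => take n a end.

Definition uedge (x : upath) (n : nat) : option E :=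
  match x with UInf p => Some (p n) | UFin a _ => onth a n end.

Definition ucat (a : seq E) (x : upath) : upath :=
  match x with
  | UInf p => UInf (fun i => nth (p (i - size a)%N) a i)
  | UFin b v => UFin (a ++ b) v
  end.

(* [X_A], [X_a], [X_{b^-1}] and [X_{bA}]. *)
Definition Xset (A : set V) : set X := [set x | A (usrc (val x))].

Definition Xpos (a : seq E) : set X := [set x | utake (size a) (val x) = a].

Definition Xneg (b : seq E) : set X := [set x | path_rng b (usrc (val x))].

Definition Xposset (b : seq E) (A : set V) : set X := [set x | Xpos b x /\
  ((exists2 e, uedge (val x) (size b) = Some e & A (src e)) \/
   (exists2 v, val x = UFin b v & A v))].

(* The pairs [(a, b)] for which [a b^-1] is a reduced word whose set [X_{ab^-1}]
   is not declared to be empty. *)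
Definition mixed (a b : seq E) : Prop :=
  [/\ fpath a, fpath b, last_edge a != last_edge b
    & path_rng a `&` path_rng b !=set0].

Definition Xmixed (a b : seq E) : set X :=
  Xposset a (path_rng a `&` path_rng b).

Local Notation F := (freegroup E).
Local Notation w := (@fg_word E).

Definition Xfg (c : F) : set X := [set x |
  [\/ c = 1%g,
      exists a, [/\ fpath a, c = w a & Xpos a x],
      exists b, [/\ fpath b, c = (w b)^-1%g & Xneg b x]
    | exists a b, [/\ mixed a b, c = (w a * (w b)^-1)%g & Xmixed a b x]]].

(* The graph of [theta_a : X_{a^-1} -> X_a]. *)
Definition theta_pos (a : seq E) (x y : X) : Prop :=
  Xneg a x /\ val y = ucat a (val x).

(* The graph of the partial map [theta_c : X_{c^-1} -> X_c]. *)
Definition theta_graph (c : F) (x y : X) : Prop :=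
  [\/ c = 1%g /\ x = y,
      exists a, [/\ fpath a, c = w a & theta_pos a x y],
      exists b, [/\ fpath b, c = (w b)^-1%g & theta_pos b y x]
    | exists a b, [/\ mixed a b, c = (w a * (w b)^-1)%g, Xmixed b a x
        & exists2 z, val x = ucat b z & val y = ucat a z]].

(* [theta_c] as a total map, with value [x] at any [x] outside [X_{c^-1}]. *)
Definition theta (c : F) (x : X) : X := xget x [set y | theta_graph c x y].

End Paths.

Notation bpath G := (set_type (@boundary G)).

Section PartialSkew.
Variables (R : comPzRingType) (G : ultragraph).
Local Notation V := (vertex G).
Local Notation E := (edge G).
Local Notation F := (freegroup E).
Local Notation fct := (bpath G -> R^o).

Definition is_submodule (U : lmodType R) (M : set U) : Prop :=
  [/\ M 0, (forall f g, M f -> M g -> M (f + g))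
    & (forall (k : R) f, M f -> M (k *: f))].

Definition is_subalgebra (M : set fct) : Prop :=
  is_submodule M /\ (forall f g, M f -> M g -> M (f * g)).

Definition span (S : set fct) : set fct := smallest (@is_submodule _) S.

Definition gensA : set fct := [set \1_(Xset A) | A in gvset G].
Definition gensbA : set fct :=
  [set \1_(Xposset b A) | b in @fpath G & A in gvset G].
Definition gens_fg (C : set F) : set fct := [set \1_(Xfg c) | c in C].

Definition Dalg : set fct :=
  smallest is_subalgebra (gensA `|` gensbA `|` gens_fg [set c | c != 1%g]).

Definition Dideal (t : F) : set fct :=
  if t == 1%g then Dalg else
  span [set \1_(Xfg t) * f | f in gensA `|` gensbA `|` gens_fg setT].

(* [beta_t] is only meant to be applied to elements of [Dideal t^-1]. *)
Definition beta (t : F) (f : fct) : fct :=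
  fun x => if x \in Xfg t then f (theta t^-1%g x) else 0.

(* A family [a : F -> fct] stands for the formal sum of the [a t] delta_t. *)
Definition pskew_set : set (F -> fct) := [set a |
  (forall t, Dideal t (a t)) /\ finite_set [set t | a t != 0]].

Definition delta (t : F) (f : fct) : F -> fct :=
  fun u => if u == t then f else 0.

(* The coefficient at [u] of the product collects the terms
   (a_t delta_t) (b_s delta_s) with t s = u, i.e. s = t^-1 u; it is a finite sum
   when [a] has finite support.  It is defined on all families; that [pskew_set]
   is closed under it amounts to beta being a partial action. *)
Definition pskew_mul (a b : F -> fct) : F -> fct := fun u =>
  \sum_(t \in [set: F]) beta t (beta t^-1%g (a t) * b (t^-1 * u)%g).

Lemma is_submodule_smallest (U : lmodType R) (C : set U -> Prop) (S : set U) :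
  (forall M, C M -> is_submodule M) -> is_submodule (smallest C S).
Proof.
move=> CM; split=> [M [/CM[]]//|f g Sf Sg M MS|k f Sf M MS].
  by case: (CM M MS.1) => _ + _; apply; [apply: Sf | apply: Sg].
by case: (CM M MS.1) => _ _; apply; apply: Sf.
Qed.

Lemma Dideal_submodule t : is_submodule (Dideal t).
Proof.
rewrite /Dideal; case: ifP => _; apply: is_submodule_smallest => //.
by move=> M [].
Qed.

Lemma pskew_submodule : is_submodule pskew_set.
Proof.
have supp0 (a b : F -> fct) : (forall t, a t = 0 -> b t = 0) ->
    finite_set [set t | a t != 0] -> finite_set [set t | b t != 0].
  move=> ab; apply: sub_finite_set => t /=.
  by apply: contra_neq => /ab.
split=> [|a b [Da fa] [Db fb]|k a [Da fa]]; split.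
- by move=> t; case: (Dideal_submodule t).
- rewrite (_ : [set _ | _] = set0); first exact: finite_set0.
  by apply/seteqP; split=> t //=; rewrite eqxx.
- by move=> t; case: (Dideal_submodule t) => _ DD _; apply: DD.
- apply: (@sub_finite_set _ _ ([set t | a t != 0] `|` [set t | b t != 0])).
    move=> t /=; case: (eqVneq (a t) 0) => [a0|]; last by left.
    by rewrite [X in X != 0](_ : _ = b t) ?[X in X = _]add0r; [right|
      rewrite -[RHS]add0r -a0].
  by rewrite finite_setU.
- by move=> t; case: (Dideal_submodule t) => _ _; apply.
- by apply: supp0 fa => t a0; rewrite -[LHS]/(k *: a t) a0 scaler0.
Qed.

Definition pskew_pred : {pred F -> fct} := fun a => a \in pskew_set.

Lemma pskew_submod_closed : submod_closed pskew_pred.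
Proof.
case: pskew_submodule => S0 SD SZ; split; first exact/mem_set.
by move=> k a b /set_mem Sa /set_mem Sb; apply/mem_set/SD => //; apply: SZ.
Qed.

HB.instance Definition _ :=
  GRing.isSubmodClosed.Build R (F -> fct) pskew_pred pskew_submod_closed.

Record pskew : Type :=
  PSkew { pskew_val : F -> fct; _ : pskew_val \in pskew_pred }.

HB.instance Definition _ := [isSub for pskew_val].
HB.instance Definition _ := [Choice of pskew by <:].
HB.instance Definition _ := [SubChoice_isSubLmodule of pskew by <:].

End PartialSkew.

Arguments pskew : clear implicits.

(* Main.v *)
From HB Require Import structures.
From mathcomp Require Import all_boot all_order all_algebra.
From mathcomp Require Import boolp classical_sets functions cardinality fsbigop.
From mathcomp Require Import numfun.
Require Import Defs.

Set Implicit Arguments.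
Unset Strict Implicit.
Unset Printing Implicit Defensive.

Import GRing.Theory.

Local Open Scope classical_set_scope.
Local Open Scope ring_scope.

(** The algebra acts on functions on [F * X], where [F] is the free group and [X]
    the set of boundary paths, by the left regular representation of the skew
    ring: [p_A] restricts a function to [X_A], while [s_e] and [s_e^*] move
    boundary paths by the partial action and the first coordinate by
    translation.  Operators compose associatively, so the relations of a Leavitt
    family are pointwise identities ([rep_family]); universality gives an action
    [rep], and [phi0 x] is the image under [rep x] of the unit family, the family
    whose only nonzero coefficient is the constant function 1 at the neutral
    element.  The algebra is spanned by the monomials [s_a p_A s_b^*]
    ([leavitt_span]), and such a monomial acts as the element of the skew ring
    that carries the characteristic function of a piece of [X_t] at
    [t = a b^-1] ([phi0_mono]).  Hence [phi0 x] lies in the skew ring, [rep x] is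
    left multiplication by [phi0 x] ([rep_pskew_mul]), and [phi0] is
    multiplicative.

    All of this rests on one description of the partial action: [t] moves [y] to
    [x] exactly when [x] and [y] arise from a common tail by prefixing words [a]
    and [b] with [t = a b^-1] ([arrow_theta]).  Such arrows obviously compose,
    and [x] and [t] determine [y] because the reduced pair [(a, b)] can be read
    off the reduced word [t].

    For surjectivity it is enough to reach the generators of the ideals [D_t].
    The main case is [1_t delta_t], which comes from [s_a p_A s_b^*] with
    [t = a b^-1] reduced and [A] the intersection of the ranges of [a] and [b]
    ([phi0_hits_Xfg]).

    For injectivity, an element of the kernel splits into its homogeneous
    components for the degree [a b^-1], which again lie in the kernel
    ([phi0_inj]).  Removing prefixes by multiplication with [s_e^*] on the left
    and [s_e] on the right reduces a homogeneous element to a diagonal one, a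
    combination of the [s_c p_A s_c^*] ([rep_corner_inj]).  For diagonal elements
    the argument is by induction on the length of the words ([rep_diag_inj]):
    compression by an edge shortens the words, and what the compressions do not
    see is a combination of differences of [p_v] and the sum of the [s_e s_e^*]
    with [src e = v], which vanishes by the Cuntz-Krieger relation because boundary
    paths start at every vertex and test every edge ([diag0_of_compress]).  The base of the argument is that a
    combination of the [p_A] that vanishes as a function on vertices vanishes
    ([proj_comb0]). *)

(** * Words in the free group *)

Section Words.
Variable G : ultragraph.
Local Notation T := (edge G).
Implicit Types a b c : seq T.
Local Notation w := (@fg_word T).

Lemma cat_red_cat (u v : seq (T * bool)) :
  reduced (u ++ v) -> cat_red u v = u ++ v.
Proof.
elim: u => //= l u IHu r; rewrite IHu; last exact: path_sorted r.
by move: r; case: (u ++ v) => //= l' s /andP[/negbTE ->].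
Qed.

Lemma fg_word_nil : w [::] = 1%g.
Proof. by rewrite /fg_word big_nil. Qed.

Lemma fg_word_cons x a : w (x :: a) = (fg_gen x * w a)%g.
Proof. by rewrite /fg_word big_cons. Qed.

Lemma fg_word_cat a b : w (a ++ b) = (w a * w b)%g.
Proof. by rewrite /fg_word big_cat. Qed.

Lemma fg_word1 x : w [:: x] = fg_gen x.
Proof. by rewrite /fg_word big_seq1. Qed.

Lemma fgval_word a : fgval (w a) = [seq (x, false) | x <- a].
Proof.
elim: a => [|x a IHa]; first by rewrite fg_word_nil.
by rewrite fg_word_cons /= IHa; case: a {IHa} => //= y a; case: eqP.
Qed.

(** Exactly the condition under which no letter cancels in [w a * (w b)^-1]. *)
Definition unlinked a b : Prop :=
  [\/ a = [::], b = [::] | last_edge a != last_edge b].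

Lemma last_edge_rcons a x : last_edge (rcons a x) = Some x.
Proof. by rewrite /last_edge rev_rcons. Qed.

Lemma unlinked_root a b :
  exists a0 b0 c, [/\ a = a0 ++ c, b = b0 ++ c & unlinked a0 b0].
Proof.
elim/last_ind: a b => [|a x IHa] b.
  by exists [::], b, [::]; rewrite !cats0; split=> //; constructor 1.
case/lastP: b => [|b y].
  by exists (rcons a x), [::], [::]; rewrite !cats0; split=> //; constructor 2.
have [<-|xy] := eqVneq x y; last first.
  exists (rcons a x), (rcons b y), [::]; rewrite !cats0; split=> //.
  by constructor 3; rewrite !last_edge_rcons; apply: contra_neq xy => -[].
have [a0 [b0 [c [-> -> u]]]] := IHa b.
by exists a0, b0, (rcons c x); rewrite -!rcons_cat.
Qed.

Lemma fgval_unlinked a b : unlinked a b ->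
  fgval (w a * (w b)^-1)%g =
    [seq (x, false) | x <- a] ++ [seq (x, true) | x <- rev b].
Proof.
have E u : rev (map (@letter_inv T) [seq (x, false) | x <- u]) =
           [seq (x, true) | x <- rev u] by rewrite map_rev -map_comp.
have rT (u : seq T) : reduced [seq (x, true) | x <- u].
  rewrite /reduced sorted_map; elim: u => //= x [|y u] //= ->.
  by rewrite andbT; apply/eqP => -[].
have rF (u : seq T) : reduced [seq (x, false) | x <- u].
  rewrite /reduced sorted_map; elim: u => //= x [|y u] //= ->.
  by rewrite andbT; apply/eqP => -[].
move=> u; rewrite -[LHS]/(cat_red (fgval (w a))
  (rev (map (@letter_inv T) (fgval (w b))))).
rewrite !fgval_word E; apply: cat_red_cat.
case/lastP: a u => [|a x] u; first exact: rT.
case/lastP: b u => [|b y] u; first by rewrite cats0; apply: rF.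
rewrite rev_rcons map_rcons cat_rcons /= /reduced.
case: u => [/(congr1 size)|/(congr1 size)|]; rewrite ?size_rcons // !last_edge_rcons.
move=> xy; have {xy}xy : y != x by apply: contra_neq xy => ->.
have: sorted (fun l l' => l' != letter_inv l)
    ([seq (z, false) | z <- a] ++ [:: (x, false)]).
  by rewrite cats1 -map_rcons; apply: rF.
have := rT (y :: rev b); rewrite /reduced /=.
case: a => [|z a] /=.
  by move=> -> _; rewrite andbT; apply: contra_neq xy => -[].
rewrite !cat_path /= andbT => -> /andP[-> ->] /=; rewrite andbT.
by apply: contra_neq xy => -[].
Qed.

(** The letters of either sign in the reduced word spell the two given words. *)
Lemma unlinked_inj a b a' b' : unlinked a b -> unlinked a' b' ->
  (w a * (w b)^-1 = w a' * (w b')^-1)%g -> a = a' /\ b = b'.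
Proof.
move=> u u' /(congr1 (@fgval T)); rewrite !fgval_unlinked // => E.
have F s s' :
    filter snd ([seq (x : T, false) | x <- s] ++ [seq (x : T, true) | x <- s']) =
    [seq (x, true) | x <- s'].
  rewrite filter_cat -[RHS]cat0s; congr (_ ++ _); first by elim: s.
  by elim: s' => //= x s' ->.
have: filter snd ([seq (x, false) | x <- a] ++ [seq (x, true) | x <- rev b]) =
  filter snd ([seq (x, false) | x <- a'] ++ [seq (x, true) | x <- rev b'])
  by rewrite E.
rewrite !F => /inj_map revE; have bb : b = b'.
  by apply: (can_inj revK); apply: revE => x y [].
split=> //; have /(congr1 size) := E; rewrite bb !size_cat !size_map => /addIn sz.
move/(congr1 (take (size a))): E; rewrite !take_size_cat ?size_map //.
move=> /inj_map H; apply: H.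
by move=> x y [].
Qed.

(** Cancelling common last letters leads from either pair to the one pair that is
    spelled by the reduced word. *)
Lemma common_root a b a' b' : (w a * (w b)^-1 = w a' * (w b')^-1)%g ->
  exists a0 b0 c c',
    [/\ unlinked a0 b0, a = a0 ++ c, b = b0 ++ c, a' = a0 ++ c' & b' = b0 ++ c'].
Proof.
have [a0 [b0 [c [-> -> u]]]] := unlinked_root a b.
have [a1 [b1 [c' [-> -> u']]]] := unlinked_root a' b'.
rewrite !fg_word_cat !invgM !mulgA !mulgK => /(unlinked_inj u u')[<- <-].
by exists a0, b0, c, c'.
Qed.

End Words.

(** * Prefixes of boundary paths *)

Section Prefixes.
Variable G : ultragraph.
Local Notation V := (vertex G).
Local Notation E := (edge G).
Implicit Types (a b c : seq E) (z : upath G).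

Definition udrop n z : upath G :=
  match z with
  | UInf p => UInf (fun i => p (n + i)%N)
  | UFin b v => UFin (drop n b) v
  end.

Lemma utake_ucat a z : utake (size a) (ucat a z) = a.
Proof.
case: z => [p|b v] /=; last exact: take_size_cat.
case: a => [|e a]; first by [].
apply: (@eq_from_nth _ e); first by rewrite size_mkseq.
by move=> i; rewrite size_mkseq => ia; rewrite nth_mkseq //; apply: set_nth_default.
Qed.

Lemma udrop_ucat a z : udrop (size a) (ucat a z) = z.
Proof.
case: z => [p|b v] /=; last by rewrite drop_size_cat.
congr UInf; apply/funext => i.
by rewrite nth_default ?leq_addr // addKn.
Qed.

Lemma ucat_inj a : injective (ucat a).
Proof. exact: can_inj (udrop_ucat a). Qed.

Lemma ucat1_inj e f z z' : ucat [:: e] z = ucat [:: f] z' -> e = f.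
Proof.
move=> E0; have := utake_ucat [:: f] z'.
by rewrite -E0 -[size _]/(size [:: e]) utake_ucat => -[].
Qed.

Lemma utakeP a z : utake (size a) z = a -> z = ucat a (udrop (size a) z).
Proof.
case: z => [p|b v] /= E; last by rewrite -{1}(cat_take_drop (size a) b) E.
congr UInf; apply/funext => i; have [ia|ia] := ltnP i (size a).
  by rewrite -[in nth _ _ _]E nth_mkseq.
by rewrite nth_default // subnKC.
Qed.

Lemma ucat0 z : ucat [::] z = z.
Proof.
by case: z => [p|b v] //=; congr UInf; apply/funext => i; rewrite nth_nil subn0.
Qed.

Lemma ucat_cat a b z : ucat (a ++ b) z = ucat a (ucat b z).
Proof.
case: z => [p|c v] /=; last by rewrite catA.
congr UInf; apply/funext => i; rewrite nth_cat size_cat.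
case: ltnP => ia; first exact: set_nth_default.
by rewrite subnDA [RHS]nth_default.
Qed.

Lemma utake_le a b z : (size a <= size b)%N ->
  utake (size a) (ucat b z) = take (size a) b.
Proof.
move=> ab; rewrite -{1}[b](cat_take_drop (size a)) ucat_cat.
by rewrite -{1}[in LHS](size_takel ab) utake_ucat.
Qed.

Lemma ucat_comparable a z a' z' : ucat a z = ucat a' z' ->
  (exists c, a' = a ++ c /\ z = ucat c z') \/
  (exists c, a = a' ++ c /\ z' = ucat c z).
Proof.
wlog le : a z a' z' / (size a <= size a')%N.
  move=> wl E; case/orP: (leq_total (size a) (size a')) => le; first exact: wl.
  by case: (wl _ _ _ _ le (esym E)); [right|left].
move=> E; left; exists (drop (size a) a').
have E1 : a' = a ++ drop (size a) a'.
  by rewrite -{1}(cat_take_drop (size a) a') -(utake_le z' le) -E utake_ucat.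
by split=> //; apply: (@ucat_inj a); rewrite E {1}E1 ucat_cat.
Qed.

Lemma boundary_ucat_cons e z :
  boundary (ucat [:: e] z) <-> boundary z /\ rng e (usrc z).
Proof.
rewrite /boundary /=; case: z => [p|b v] /=.
  split=> [h|[h r] [|i] /=]; last by rewrite !nth_nil !subn1; apply: (h i).
    split=> [i|]; first by have /= := h i.+1; rewrite !nth_nil !subn1.
    by have /= := h 0%N; rewrite /follows => /set_mem.
  by rewrite /follows; apply/mem_set.
have lE f (l : seq E) : last_edge (e :: f :: l) = last_edge (f :: l).
  by case/lastP: l => [|l g]; rewrite // -!rcons_cons !last_edge_rcons.
case: b => [|f b] /=.
  split=> [[sv [//|[_]]]|[[sv _] r]].
    by move=> /= r; split=> //; split=> //; left.
  by split=> //; right.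
rewrite /fpath /path_rng lE; split.
  move=> [sv [//|[[_ /= /andP[/set_mem fl s]] r]]].
  by split=> //; split=> //; right.
move=> [[sv [//|[[_ s] r]]] h]; split=> //; right; split=> //; split=> //=.
by rewrite /follows mem_set.
Qed.

Lemma path_rng_cons e f a : path_rng (e :: f :: a) = path_rng (f :: a).
Proof.
rewrite /path_rng (_ : last_edge (e :: f :: a) = last_edge (f :: a)) //.
by case/lastP: a => [|l g]; rewrite // -!rcons_cons !last_edge_rcons.
Qed.

Lemma usrc_ucat_cons e a z : usrc (ucat (e :: a) z) = src e.
Proof. by case: z. Qed.

Lemma boundary_ucat a z : a != [::] ->
  boundary (ucat a z) <-> [/\ boundary z, fpath a & path_rng a (usrc z)].
Proof.
case: a => // e a _; elim: a e => [|f a IHa] e.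
  rewrite boundary_ucat_cons; split=> [[]|[]] //.
by rewrite (ucat_cat [:: e]) boundary_ucat_cons IHa usrc_ucat_cons path_rng_cons;
  split=> [[[bz [_ s] r] ef]|[bz [_ /= /andP[/set_mem ef s]] r]]; split=> //;
  split=> //=; rewrite /follows mem_set.
Qed.

Lemma boundary_suffix a z : boundary (ucat a z) -> boundary z.
Proof.
by case: a => [|e a]; [rewrite ucat0|case/(@boundary_ucat (e :: a))].
Qed.

(** If no boundary path started at [v], then [v] would not be a sink, and it would
    emit an edge in whose range no boundary path starts either; iterating this
    choice would produce an infinite path from [v]. *)
Lemma boundary_at (v : V) : exists z, boundary z /\ usrc z = v.
Proof.
pose bad u := ~ exists z, boundary z /\ usrc z = u.
apply: contrapT => badv.
have next (u : {u | bad u}) : exists q : E * {u | bad u},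
    src q.1 = sval u /\ rng q.1 (sval q.2).
  case: u => u bu /=; have [e eu] : exists e : E, src e = u.
    apply: contrapT => nu; apply: bu; exists (UFin [::] u); split=> //=.
    by split; [move=> e; apply/eqP => eu; apply: nu; exists e | left].
  have [u' ru'] := rng_neq0 e.
  have bu' : bad u'.
    move=> [z [bz zu']]; apply: bu; exists (ucat [:: e] z).
    by rewrite boundary_ucat_cons zu' usrc_ucat_cons.
  by exists (e, exist _ u' bu').
have [f fP] := choice next.
pose q n := f (iter n (fun u => (f u).2) (exist _ v badv)).
apply: (badv); exists (UInf (fun n => (q n).1)); split; last by rewrite /= (fP _).1.
by move=> i /=; rewrite /follows /q /= (fP _).1; apply/mem_set; apply: (fP _).2.
Qed.

Lemma XpossetP b (A : set V) (x : bpath G) :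
  Xposset b A x <-> exists z, val x = ucat b z /\ A (usrc z).
Proof.
rewrite /Xposset /Xpos /=; split=> [[/utakeP E h]|[z [-> Az]]]; last first.
  split; first exact: utake_ucat.
  case: z Az => [p|[|e l] v] /= Az.
  - by left; exists (p 0%N) => //; rewrite nth_default // subnn.
  - by right; exists v; rewrite ?cats0.
  - by left; exists e => //; rewrite onth_cat ltnn subnn.
exists (udrop (size b) (val x)); split=> //; move: E h.
set z := udrop _ _ => ->; case: z => [p|l v] /=.
  by case=> [[e [<-] Ae]|[]//]; move: Ae; rewrite nth_default // subnn.
case=> [[e el Ae]|[u [E <-] Au]].
  move: el; rewrite onth_cat ltnn subnn; by case: l => //= f l [->].
move/(congr1 size): E; rewrite size_cat => /eqP.
by rewrite -{2}[size b]addn0 eqn_add2l; case: l.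
Qed.

End Prefixes.

(** * The partial action on boundary paths *)

Section Arrows.
Variable G : ultragraph.
Local Notation V := (vertex G).
Local Notation E := (edge G).
Local Notation X := (bpath G).
Local Notation F := (freegroup E).
Local Notation w := (@fg_word E).
Implicit Types (a b c : seq E) (x y : X) (t s : F).

(** The transformation groupoid of the partial action.  The words are arbitrary,
    not only those of a reduced pair, so that arrows compose. *)
Definition arrow t x y : Prop := exists a b z,
  [/\ val x = ucat a z, val y = ucat b z & t = (w a * (w b)^-1)%g].

Lemma arrow1 x : arrow 1%g x x.
Proof. by exists [::], [::], (val x); rewrite ucat0 mulgV. Qed.

Lemma arrowV t x y : arrow t x y -> arrow t^-1%g y x.
Proof. by move=> [a [b [z [? ? ->]]]]; exists b, a, z; rewrite invgF. Qed.

Lemma arrowM t s x y z : arrow t x y -> arrow s y z -> arrow (t * s)%g x z.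
Proof.
move=> [a [b [u [xE yE ->]]]] [a' [b' [u' [yE' zE ->]]]].
case: (@ucat_comparable _ b u a' u'); first by rewrite -yE.
  move=> [c [bE uE]]; exists (a ++ c), b', u'.
  rewrite ucat_cat -uE; split=> //.
  by rewrite bE !fg_word_cat !mulgA mulgVK.
move=> [c [bE uE]]; exists a, (b' ++ c), u.
rewrite ucat_cat -uE; split=> //.
by rewrite bE !fg_word_cat !invgM !mulgA mulgVK.
Qed.

Lemma arrow_fun t x y y' : arrow t x y -> arrow t x y' -> y = y'.
Proof.
move=> [a [b [z [xE yE ->]]]] [a' [b' [z' [xE' yE']]]].
move=> /common_root[a0 [b0 [c [c' [_ aE bE aE' bE']]]]].
apply: val_inj; rewrite yE yE' bE bE' !ucat_cat.
congr ucat; apply: (@ucat_inj _ a0).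
by rewrite -!ucat_cat -aE -aE' -xE.
Qed.

(** Words with a common suffix are shortened until the pair is reduced; the range
    conditions that enter [theta_graph] then hold because both paths lie in the
    boundary. *)
Lemma arrow_theta t x y : theta_graph t x y <-> arrow t y x.
Proof.
split.
  case=> [[-> ->]|[a [_ -> [_ yE]]]|[b [_ -> [_ xE]]]|[a [b [_ -> _ [z xE yE]]]]].
  - exact: arrow1.
  - by exists a, [::], (val x); rewrite ucat0 fg_word_nil divg1.
  - by exists [::], b, (val y); rewrite ucat0 fg_word_nil mul1g.
  - by exists a, b, z.
move=> [a [b [z [yE xE ->]]]].
have [a0 [b0 [c [aE bE u]]]] := unlinked_root a b.
have -> : (w a * (w b)^-1 = w a0 * (w b0)^-1)%g.
  by rewrite aE bE !fg_word_cat invgM !mulgA mulgK.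
move: yE xE; rewrite aE bE !ucat_cat; move: (ucat c z) => {a b c z aE bE} z yE xE.
have by_ := set_valP y; have bx := set_valP x.
have [a00|a0N] := eqVneq a0 [::]; have [b00|b0N] := eqVneq b0 [::].
- constructor 1; rewrite a00 b00 mulgV; split=> //; apply: val_inj.
  by rewrite yE xE a00 b00.
- constructor 3; exists b0; rewrite a00 fg_word_nil mul1g.
  move: yE; rewrite a00 ucat0 => yE.
  move: bx; rewrite /= xE => /(boundary_ucat _ b0N)[_ pb rb].
  by split=> //; split; rewrite /Xneg /= yE.
- constructor 2; exists a0; rewrite b00 fg_word_nil divg1.
  move: xE; rewrite b00 ucat0 => xE.
  move: by_; rewrite /= yE => /(boundary_ucat _ a0N)[_ pa ra].
  by split=> //; split; rewrite /Xneg /= xE.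
- constructor 4; exists a0, b0.
  move: bx; rewrite /= xE => /(boundary_ucat _ b0N)[_ pb rb].
  move: by_; rewrite /= yE => /(boundary_ucat _ a0N)[_ pa ra].
  split=> //; last by exists z.
    split=> //; last by exists (usrc z).
    by case: u => // E; rewrite E ?eqxx in a0N b0N.
  by apply/XpossetP; exists z.
Qed.

Lemma XfgP t x : Xfg t x <-> exists y, arrow t x y.
Proof.
split; last first.
  move=> [y /arrow_theta]; case=> [[-> _]|[a [pa -> [_ xE]]]|[b [pb -> [xb _]]]|].
  - by constructor 1.
  - by constructor 2; exists a; split=> //; rewrite /Xpos /= xE utake_ucat.
  - by constructor 3; exists b.
  - move=> [a [b [m -> _ [z yE xE]]]]; constructor 4; exists a, b; split=> //.
    case: m => /= pa pb _ _; have := set_valP x; have := set_valP y.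
    rewrite /= xE yE => /boundary_ucat[|_ _ rb]; first by case: pb.
    move=> /boundary_ucat[|_ _ ra]; first by case: pa.
    by apply/XpossetP; exists z.
case=> [->|[a [pa -> /utakeP xE]]|[b [pb -> xb]]|[a [b [[pa pb _ _] -> /XpossetP]]]].
- by exists x; apply: arrow1.
- have := set_valP x; rewrite /= xE => /boundary_suffix bz.
  exists (SigSub (mem_set bz)), a, [::], (udrop (size a) (val x)).
  by rewrite ucat0 fg_word_nil divg1.
- have bz : boundary (ucat b (val x)).
    by apply/boundary_ucat; [case: pb|split=> //; apply: set_valP].
  exists (SigSub (mem_set bz)), [::], b, (val x).
  by rewrite ucat0 fg_word_nil mul1g.
- move=> [z [xE [ra rb]]].
  have bz : boundary (ucat b z).
    apply/boundary_ucat; [by case: pb|split=> //].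
    by apply: (@boundary_suffix _ a); rewrite -xE; apply: set_valP.
  by exists (SigSub (mem_set bz)), a, b, z.
Qed.

Lemma thetaE t x y : arrow t x y -> theta t^-1%g x = y.
Proof.
move=> txy; have h : theta_graph t^-1%g x y by apply/arrow_theta/arrowV.
rewrite /theta; case: xgetP => [y' _ /= /arrow_theta/arrowV|/(_ y)//].
by rewrite invgK => /(arrow_fun txy).
Qed.

Lemma Xfg1 x : Xfg 1%g x.
Proof. by apply/XfgP; exists x; apply: arrow1. Qed.

Lemma arrowX t x y : arrow t x y -> Xfg t x.
Proof. by move=> h; apply/XfgP; exists y. Qed.

Lemma Xfg_unlinked a b x : unlinked a b -> Xfg (w a * (w b)^-1)%g x ->
  exists z, val x = ucat a z /\ boundary (ucat b z).
Proof.
move=> u /XfgP[y [a' [b' [z [xE yE]]]]].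
move=> /common_root[a0 [b0 [c [c' [u0 aE bE aE' bE']]]]].
have [a0E b0E] : a = a0 /\ b = b0.
  apply: unlinked_inj => //.
  by rewrite aE bE !fg_word_cat invgM !mulgA mulgK.
exists (ucat c' z); rewrite a0E b0E -!ucat_cat -aE' -bE' -yE; split=> //.
exact: set_valP.
Qed.

Lemma XwordP a x : Xfg (w a) x <-> exists z, val x = ucat a z.
Proof.
split.
  have u : unlinked a [::] by constructor 2.
  rewrite -{1}[w a]divg1 -fg_word_nil => /(Xfg_unlinked u)[z [xE _]].
  by exists z.
move=> [z xE]; have := set_valP x; rewrite /= xE => /boundary_suffix bz.
apply: (@arrowX _ _ (SigSub (mem_set bz))); exists a, [::], z.
by rewrite ucat0 fg_word_nil divg1.
Qed.

Lemma Xword_prefix a b x : Xfg (w (a ++ b)) x -> Xfg (w a) x.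
Proof.
by move=> /XwordP[z xE]; apply/XwordP; exists (ucat b z); rewrite -ucat_cat.
Qed.

Lemma Xword_suffixV a b x : Xfg (w (a ++ b))^-1%g x -> Xfg (w b)^-1%g x.
Proof.
move=> /XfgP[y xy]; have := arrowX (arrowV xy); rewrite invgK => /XwordP[z yE].
have := set_valP y; rewrite /= yE ucat_cat => /boundary_suffix bz.
suff /(arrowM xy) : arrow (w a) y (SigSub (mem_set bz)).
  by rewrite fg_word_cat invgM mulgVK => /arrowX.
by exists a, [::], (ucat b z); rewrite ucat0 -ucat_cat fg_word_nil divg1.
Qed.

Lemma XgenVP e x : Xfg (fg_gen e)^-1%g x <-> rng e (usrc (val x)).
Proof.
split=> [/XfgP[y /arrowV]|r].
  rewrite invgK => yx; have /XwordP[z yE] : Xfg (w [:: e]) y.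
    by rewrite fg_word1; apply: arrowX yx.
  have := set_valP y; rewrite /= yE => /boundary_ucat_cons[bz].
  have : arrow (fg_gen e) y (SigSub (mem_set bz)).
    by exists [:: e], [::], z; rewrite ucat0 fg_word_nil fg_word1 divg1.
  by move=> /(arrow_fun yx) ->.
have bz : boundary (ucat [:: e] (val x)).
  by apply/boundary_ucat_cons; split=> //; apply: set_valP.
apply: (@arrowX _ _ (SigSub (mem_set bz))).
by exists [::], [:: e], (val x); rewrite ucat0 fg_word_nil fg_word1 mul1g.
Qed.

End Arrows.

(** * The regular representation *)

Section Endomorphisms.
Variables (R : comPzRingType) (U : lmodType R).

Definition lin_pred : {pred U -> U} := fun f => `[< linear f >].

Lemma lin_predP f : reflect (linear f) (f \in lin_pred).
Proof. exact: asboolP. Qed.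

Lemma lin_submod_closed : submod_closed lin_pred.
Proof.
split=> [|k f g /lin_predP lf /lin_predP lg]; apply/lin_predP => l u v /=.
  by rewrite /GRing.zero /= scaler0 addr0.
rewrite -[LHS]/(k *: f (l *: u + v) + g (l *: u + v)).
rewrite -[RHS]/(l *: (k *: f u + g u) + (k *: f v + g v)).
by rewrite lf lg !scalerDr !scalerA mulrC addrACA.
Qed.

HB.instance Definition _ :=
  GRing.isSubmodClosed.Build R (U -> U) lin_pred lin_submod_closed.

Record endo : Type := Endo { endo_val :> U -> U; _ : endo_val \in lin_pred }.

HB.instance Definition _ := [isSub for endo_val].
HB.instance Definition _ := [Choice of endo by <:].
HB.instance Definition _ := [SubChoice_isSubLmodule of endo by <:].

Lemma endo_linear (f : endo) : linear f.
Proof. by apply/lin_predP; case: f. Qed.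

Lemma endoD (f : endo) u v : f (u + v) = f u + f v.
Proof. by rewrite -[u]scale1r endo_linear !scale1r. Qed.

Lemma endo0 (f : endo) : f 0 = 0.
Proof. by apply: (addrI (f 0)); rewrite -endoD !addr0. Qed.

Lemma endoZ (f : endo) k u : f (k *: u) = k *: f u.
Proof. by rewrite -[k *: u]addr0 endo_linear endo0 addr0. Qed.

Lemma endo_comp_lin (f g : endo) : (f \o g) \in lin_pred.
Proof. by apply/lin_predP => k u v /=; rewrite !endo_linear. Qed.

Definition endo_comp (f g : endo) : endo := Endo (endo_comp_lin f g).

Lemma endo_compA : associative endo_comp.
Proof. by move=> f g h; apply: val_inj. Qed.

Lemma endo_compDl : left_distributive endo_comp +%R.
Proof. by move=> f g h; apply: val_inj. Qed.

Lemma endo_compDr : right_distributive endo_comp +%R.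
Proof. by move=> f g h; apply: val_inj; apply/funext => u; apply: endoD. Qed.

Lemma endo_compZl (k : R) (f g : endo) :
  k *: endo_comp f g = endo_comp (k *: f) g.
Proof. exact: val_inj. Qed.

Lemma endo_compZr (k : R) (f g : endo) :
  k *: endo_comp f g = endo_comp f (k *: g).
Proof. by apply: val_inj; apply/funext => u; apply/esym/endoZ. Qed.

HB.instance Definition _ := Lmodule_isNUAlgebra.Build R endo
  endo_compA endo_compDl endo_compDr endo_compZl endo_compZr.

End Endomorphisms.

Section VertexSets.
Variable G : ultragraph.
Local Notation V := (vertex G).
Implicit Types A B : set V.

(** The empty set, whose projection is 0 by convention, makes the family stable
    under intersections. *)
Definition gvset0 A : Prop := gvset G A \/ A = set0.

Lemma gvset_sub_setU A B : gvset G A -> gvset G B -> gvset G (A `|` B).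
Proof.
move=> gA gB M h; have [[MU _] _] := h.
by apply: MU; [apply: (gA M h)|apply: (gB M h)].
Qed.

Lemma gvset_setI A B : gvset G A -> gvset G B -> gvset0 (A `&` B).
Proof.
move=> gA gB; have [->|/set0P ne] := eqVneq (A `&` B) set0; first by right.
left=> M h; have [[_ MI] _] := h.
by apply: MI => //; [apply: (gA M h)|apply: (gB M h)].
Qed.

Lemma gvset_set1 (v : V) : gvset G [set v].
Proof. by move=> M [_ Ms]; apply: Ms; left; exists v. Qed.

Lemma gvset_rng e : gvset G (rng e).
Proof. by move=> M [_ Ms]; apply: Ms; right; exists e. Qed.

Lemma gvset0_setU A B : gvset0 A -> gvset0 B -> gvset0 (A `|` B).
Proof.
case=> [gA|->]; case=> [gB|->]; rewrite ?setU0 ?set0U; try by [left|right].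
by left; apply: gvset_sub_setU.
Qed.

Lemma gvset0_setI A B : gvset0 A -> gvset0 B -> gvset0 (A `&` B).
Proof.
case=> [gA|->]; case=> [gB|->]; rewrite ?setI0 ?set0I; try by right.
exact: gvset_setI.
Qed.

Lemma extend0 (B : Type) (z : B) (p : gvset G -> B) : extend z p set0 = z.
Proof.
rewrite /extend; case: insubP => //= u /set_mem/gvset_neq0[v] //.
Qed.

Lemma extend_val (B : Type) (z : B) (p : gvset G -> B) (A : gvset G) :
  extend z p (val A) = p A.
Proof. by rewrite /extend valK. Qed.

End VertexSets.

Section Representation.
Variables (R : comPzRingType) (G : ultragraph).
Local Notation V := (vertex G).
Local Notation E := (edge G).
Local Notation X := (bpath G).
Local Notation F := (freegroup E).
Local Notation fct := (X -> R^o).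
Local Notation M := (F -> fct).
Local Notation w := (@fg_word E).
Implicit Types (m : M) (t s u : F) (x y : X) (S : set X).

(** Left translation by [1_t delta_t]. *)
Definition transport t m : M :=
  fun u x => if x \in Xfg t then m (t^-1 * u)%g (theta t^-1%g x) else 0.

Lemma transport_arrow t x y m u :
  arrow t x y -> transport t m u x = m (t^-1 * u)%g y.
Proof.
by move=> xy; rewrite /transport mem_set ?(thetaE xy) //; apply: arrowX xy.
Qed.

Lemma transport_out t x m u : ~ Xfg t x -> transport t m u x = 0.
Proof. by move=> xt; rewrite /transport memNset. Qed.

Lemma transport_lin t : transport t \in @lin_pred R M.
Proof.
apply/lin_predP => k m m'; apply/funext => u; apply/funext => x.
rewrite -[RHS]/(k *: transport t m u x + transport t m' u x) /transport.
by case: ifP => // _; rewrite scaler0 addr0.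
Qed.

Definition restrict S m : M := fun u x => \1_S x * m u x.

Lemma restrict_lin S : restrict S \in @lin_pred R M.
Proof.
apply/lin_predP => k m m'; apply/funext => u; apply/funext => x.
rewrite -[RHS]/(k *: restrict S m u x + restrict S m' u x) /restrict.
by rewrite -[(k *: m + m') u x]/(k * m u x + m' u x) mulrDr mulrCA.
Qed.

Definition transport_endo t : endo M := Endo (transport_lin t).
Definition restrict_endo S : endo M := Endo (restrict_lin S).

Local Notation tr := transport_endo.
Local Notation restr := restrict_endo.

Lemma restrE S m u x : restr S m u x = \1_S x * m u x. Proof. by []. Qed.
Lemma trE t m u x : tr t m u x = transport t m u x. Proof. by []. Qed.
Lemma nmul_endoE (f g : endo M) m : (f ** g) m = f (g m). Proof. by []. Qed.

Lemma endoP (f g : endo M) : (forall m u x, f m u x = g m u x) -> f = g.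
Proof.
by move=> fg; apply: val_inj; apply/funext => m; apply/funext => u;
  apply/funext => x; apply: fg.
Qed.

Lemma indic1 S x : S x -> (\1_S x : R) = 1.
Proof. by move=> Sx; rewrite indicE mem_set. Qed.

Lemma indic_out S x : ~ S x -> (\1_S x : R) = 0.
Proof. by move=> Sx; rewrite indicE memNset. Qed.

Lemma indicI S S' x : (\1_(S `&` S') x : R) = \1_S x * \1_S' x.
Proof.
rewrite !indicE in_setI; case: (x \in S); last by rewrite mul0r.
by rewrite /= mul1r.
Qed.

Lemma restr_mul S S' : restr S ** restr S' = restr (S `&` S').
Proof. by apply: endoP => m u x; rewrite nmul_endoE !restrE indicI mulrA. Qed.

(** The identity that characterizes partial representations of a group. *)
Lemma tr_mul t s : tr t ** tr s = restr (Xfg t) ** tr (t * s)%g.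
Proof.
apply: endoP => m u x; rewrite !nmul_endoE restrE !trE.
have [xt|xt] := pselect (Xfg t x); last first.
  by rewrite transport_out // indic_out // mul0r.
rewrite indic1 // mul1r; have /XfgP[y xy] := xt.
rewrite (transport_arrow _ _ xy) trE.
have [/XfgP[z xz]|xts] := pselect (Xfg (t * s)%g x).
  have yz := arrowM (arrowV xy) xz; rewrite mulKg in yz.
  by rewrite (transport_arrow _ _ yz) (transport_arrow _ _ xz) invgM mulgA.
rewrite [RHS]transport_out // transport_out // => /XfgP[z yz].
by apply: xts; apply: arrowX (arrowM xy yz).
Qed.

Lemma restr_tr S t : Xfg t `<=` S -> restr S ** tr t = tr t.
Proof.
move=> tS; apply: endoP => m u x; rewrite nmul_endoE restrE trE.
have [xt|xt] := pselect (Xfg t x); last by rewrite transport_out // mulr0.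
by rewrite indic1 ?mul1r //; apply: tS.
Qed.

(** Restriction to [S] can be carried through [tr t] when [S'] is its
    translate. *)
Lemma tr_restr S t S' : (forall x y, arrow t x y -> S y <-> S' x) ->
  tr t ** restr S = restr S' ** tr t.
Proof.
move=> SS; apply: endoP => m u x; rewrite !nmul_endoE restrE !trE.
have [/XfgP[y xy]|xt] := pselect (Xfg t x); last first.
  by rewrite !transport_out // mulr0.
rewrite !(transport_arrow _ _ xy) restrE; congr (_ * _).
rewrite !indicE; congr (_%:R); congr nat_of_bool.
by apply/idP/idP => /set_mem/(SS _ _ xy)/mem_set.
Qed.

Lemma tr_restr_id S t : Xfg t^-1%g `<=` S -> tr t ** restr S = tr t.
Proof.
move=> tS; rewrite (@tr_restr _ _ setT); first by apply: restr_tr.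
by move=> x y /arrowV/arrowX/tS.
Qed.

Lemma tr1 : tr 1%g = restr setT.
Proof.
apply: endoP => m u x; rewrite trE (transport_arrow _ _ (arrow1 x)) restrE.
by rewrite invg1 mul1g indic1 // mul1r.
Qed.

Lemma restr0 : restr set0 = 0.
Proof. by apply: endoP => m u x; rewrite restrE indic_out // mul0r. Qed.

Lemma Xset0 : Xset (set0 : set V) = set0.
Proof. by apply/seteqP; split. Qed.

Definition rep_p (A : gvset G) : endo M := restr (Xset (val A)).
Definition rep_s e : endo M := tr (fg_gen e).
Definition rep_s' e : endo M := tr (fg_gen e)^-1%g.

Lemma extend_rep (A : set V) : gvset0 A -> extend 0 rep_p A = restr (Xset A).
Proof.
case=> [gA|->]; last by rewrite extend0 Xset0 restr0.
by rewrite -[A]/(val (SigSub (mem_set gA) : gvset G)) extend_val.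
Qed.

Lemma Xset_setI (A B : set V) : Xset (A `&` B) = Xset A `&` Xset B.
Proof. by []. Qed.

Lemma XgenP e x : Xfg (fg_gen e) x <-> exists z, val x = ucat [:: e] z.
Proof. by rewrite -fg_word1; apply: XwordP. Qed.

Lemma indic_disjU (I : choiceType) (l : seq I) (f : I -> set X) x : uniq l ->
  (forall i j, i != j -> f i x -> ~ f j x) ->
  \sum_(i <- l) (\1_(f i) x : R) = \1_[set y | exists2 i, i \in l & f i y] x.
Proof.
move=> ul dj; have [[i il fix_]|nf] := pselect (exists2 i, i \in l & f i x).
  rewrite [RHS]indic1; last by exists i.
  rewrite (bigD1_seq i) //= indic1 // big1_seq ?addr0 // => j /andP[ji _].
  by rewrite indic_out //; apply: dj fix_; rewrite eq_sym.
rewrite [RHS]indic_out // big1_seq // => i /= il.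
by rewrite indic_out // => fi; apply: nf; exists i.
Qed.

Lemma endo_sumE (I : Type) (l : seq I) (f : I -> endo M) m u x :
  (\sum_(i <- l) f i) m u x = \sum_(i <- l) f i m u x.
Proof.
by elim: l => [|i l IHl]; rewrite ?big_nil // !big_cons -IHl.
Qed.

(** Every relation compares sets of boundary paths.  For the Cuntz-Krieger
    relation, a boundary path from a vertex that is not a sink starts with exactly
    one edge from that vertex. *)
Lemma rep_family : leavitt_family rep_p rep_s rep_s'.
Proof.
split.
- move=> A A' gA gA'; rewrite !extend_rep ?restr_mul -?Xset_setI //; try by left.
  exact: gvset_setI.
- move=> A A' gA gA'; rewrite !extend_rep //; try by left.
  + apply: endoP => m u x.
    rewrite -[RHS]/(restr (Xset A) m u x + restr (Xset A') m u x
      - restr (Xset (A `&` A')) m u x).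
    rewrite !restrE -mulrDl -mulrBl; congr (_ * _).
    rewrite Xset_setI indicI !indicE -[Xset _ in LHS]/(Xset A `|` Xset A') in_setU.
    by case: (x \in Xset A); case: (x \in Xset A');
      rewrite /= ?mulr1 ?mul1r ?mul0r ?addrK ?subr0 ?addr0 ?add0r.
  + exact: gvset_setI.
  + by apply: gvset0_setU; left.
- move=> e; rewrite extend_rep; last by left; apply: gvset_set1.
  by apply: restr_tr => x /XgenP[z]; rewrite /Xset /= => ->; rewrite usrc_ucat_cons.
- move=> e; rewrite extend_rep; last by left; apply: gvset_rng.
  by apply: tr_restr_id => x /XgenVP.
- move=> e; rewrite extend_rep; last by left; apply: gvset_rng.
  by apply: restr_tr => x /XgenVP.
- move=> e; rewrite extend_rep; last by left; apply: gvset_set1.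
  apply: tr_restr_id => x; rewrite invgK => /XgenP[z].
  by rewrite /Xset /= => ->; rewrite usrc_ucat_cons.
- move=> e; rewrite extend_rep; last by left; apply: gvset_rng.
  rewrite tr_mul mulVg tr1 restr_mul setIT; congr restr.
  by apply/seteqP; split=> x /XgenVP.
- move=> e f ef; apply: endoP => m u x; rewrite nmul_endoE trE.
  have [/XfgP[y xy]|xe] := pselect (Xfg (fg_gen e)^-1%g x); last exact: transport_out.
  rewrite (transport_arrow _ _ xy) trE transport_out // => /XgenP[z yE].
  have := arrowX (arrowV xy); rewrite invgK => /XgenP[z'].
  by rewrite yE => /ucat1_inj fe; rewrite fe eqxx in ef.
- move=> v l ul l0 lv; rewrite extend_rep; last by left; apply: gvset_set1.
  under eq_bigr do rewrite tr_mul mulgV tr1 restr_mul setIT.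
  apply: endoP => m u x; rewrite endo_sumE restrE.
  under eq_bigr do rewrite restrE.
  rewrite -mulr_suml indic_disjU //; last first.
    move=> e f ef /XgenP[z xE] /XgenP[z']; rewrite xE => /ucat1_inj E.
    by rewrite E eqxx in ef.
  congr (\1_ _ x * _); apply/seteqP; split=> y /=; rewrite /Xset /=; last first.
    by case=> e; rewrite lv => /eqP <- /XgenP[z ->]; rewrite usrc_ucat_cons.
  case: l l0 lv {ul} => // e0 l _ lv yv.
  have ns : ~ sink v by move=> /(_ e0); rewrite -lv mem_head.
  have := set_valP y; rewrite /boundary /=; move: yv.
  case yE: (val y) => [p|[|e b] v'] /= yv; last first.
  + by move=> _; exists e; [rewrite lv yv|apply/XgenP; exists (UFin b v')].
  + by rewrite yv => -[].
  move=> _; exists (p 0%N); first by rewrite lv yv.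
  apply/XgenP; exists (udrop 1 (val y)); rewrite yE.
  by apply: (@utakeP _ [:: p 0%N]).
Qed.

End Representation.

(** * Monomials in a Leavitt family *)

Section Monomials.
Variables (R : comPzRingType) (G : ultragraph) (B : nuAlgType R).
Local Notation V := (vertex G).
Local Notation E := (edge G).
Variables (p : gvset G -> B) (s s' : E -> B).
Implicit Types (a b : seq E) (A : set V) (y z : B).

Local Notation P := (extend 0 p).

(** [sl a y] is [s_a y] and [sr b y] is [y s_b^*]; the empty word acts as the
    identity, although [B] need not have a unit. *)
Definition sl a y := foldr (fun e z => s e ** z) y a.
Definition sr b y := foldr (fun e z => z ** s' e) y b.
Definition mono a A b := sl a (sr b (P A)).

Lemma nmul0l y : 0 ** y = 0.
Proof. by apply: (addrI (0 ** y)); rewrite -nmulDl !addr0. Qed.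

Lemma nmul0r y : y ** 0 = 0.
Proof. by apply: (addrI (y ** 0)); rewrite -nmulDr !addr0. Qed.

Lemma nmulNr y z : y ** (- z) = - (y ** z).
Proof. by apply: (addrI (y ** z)); rewrite -nmulDr !subrr nmul0r. Qed.

Lemma nmul_suml (I : Type) (l : seq I) (f : I -> B) y :
  (\sum_(i <- l) f i) ** y = \sum_(i <- l) f i ** y.
Proof. by elim/big_rec2: _ => [|i u v _ <-]; rewrite ?nmul0l // nmulDl. Qed.

Lemma nmul_sumr (I : Type) (l : seq I) (f : I -> B) y :
  y ** (\sum_(i <- l) f i) = \sum_(i <- l) y ** f i.
Proof. by elim/big_rec2: _ => [|i u v _ <-]; rewrite ?nmul0r // nmulDr. Qed.

Lemma slM a y z : sl a (y ** z) = sl a y ** z.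
Proof. by elim: a => //= e a ->; rewrite nmulA. Qed.

Lemma srM b y z : sr b (y ** z) = y ** sr b z.
Proof. by elim: b => //= e b ->; rewrite nmulA. Qed.

Lemma sl_sr a b y : sl a (sr b y) = sr b (sl a y).
Proof. by elim: a => //= e a ->; rewrite srM. Qed.

Lemma sl0 a : sl a 0 = 0.
Proof. by elim: a => //= e a ->; rewrite nmul0r. Qed.

Lemma sr0 b : sr b 0 = 0.
Proof. by elim: b => //= e b ->; rewrite nmul0l. Qed.

Lemma slD a : {morph sl a : y z / y + z}.
Proof. by elim: a => //= e a IHa y z /=; rewrite IHa nmulDr. Qed.

Lemma srD b : {morph sr b : y z / y + z}.
Proof. by elim: b => //= e b IHb y z /=; rewrite IHb nmulDl. Qed.

Lemma slZ a k y : sl a (k *: y) = k *: sl a y.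
Proof. by elim: a => //= e a ->; rewrite scale_nmulAr. Qed.

Lemma srZ b k y : sr b (k *: y) = k *: sr b y.
Proof. by elim: b => //= e b ->; rewrite scale_nmulAl. Qed.

Lemma sl_cat a b y : sl (a ++ b) y = sl a (sl b y).
Proof. by rewrite /sl foldr_cat. Qed.

Lemma sr_cat a b y : sr (a ++ b) y = sr a (sr b y).
Proof. by rewrite /sr foldr_cat. Qed.

Hypothesis fam : leavitt_family p s s'.

Lemma proj_setI A A' : gvset0 A -> gvset0 A' -> P A ** P A' = P (A `&` A').
Proof.
case=> [gA|->]; last by rewrite set0I extend0 nmul0l.
by case=> [gA'|->]; [apply: (lf_pI fam)|rewrite setI0 extend0 nmul0r].
Qed.

Lemma proj_setU A A' : gvset0 A -> gvset0 A' ->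
  P (A `|` A') = P A + P A' - P (A `&` A').
Proof.
case=> [gA|->]; last by rewrite set0I set0U extend0 add0r subr0.
by case=> [gA'|->]; [apply: (lf_pU fam)|rewrite setI0 setU0 extend0 addr0 subr0].
Qed.

Lemma proj_src A e : gvset0 A ->
  P (A `&` [set src e]) = if src e \in A then P [set src e] else 0.
Proof.
move=> gA; case: ifPn => [/set_mem eA|/negP eA].
  by congr P; apply/seteqP; split=> v /=; [case|move=> ->].
rewrite -[RHS](extend0 0 p); congr P; apply/seteqP; split=> v //= [Av ve].
by apply: eA; rewrite -ve; apply/mem_set.
Qed.

Lemma proj_s A e : gvset0 A -> P A ** s e = if src e \in A then s e else 0.
Proof.
move=> gA; rewrite -(lf_src_s fam) nmulA proj_setI //; last by left; apply: gvset_set1.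
by rewrite proj_src //; case: ifP => _; rewrite ?nmul0l.
Qed.

Lemma s'_proj A e : gvset0 A -> s' e ** P A = if src e \in A then s' e else 0.
Proof.
move=> gA; rewrite -(lf_s'_src fam) -nmulA proj_setI //; last by left; apply: gvset_set1.
by rewrite setIC proj_src //; case: ifP => _; rewrite ?nmul0r.
Qed.

Lemma s'_s e f y : s' e ** (s f ** y) = if e == f then P (rng e) ** y else 0.
Proof.
rewrite nmulA; case: eqVneq => [<-|ef]; first by rewrite (lf_s's_eq fam).
by rewrite (lf_s's_neq fam) ?nmul0l.
Qed.

Lemma s_s' e f y : (y ** s' f) ** s e = if e == f then y ** P (rng e) else 0.
Proof.
rewrite -nmulA; case: eqVneq => [<-|ef]; first by rewrite (lf_s's_eq fam).
by rewrite (lf_s's_neq fam) ?nmul0r // eq_sym.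
Qed.

Lemma proj_mono A a A' b : gvset0 A -> gvset0 A' ->
  P A ** mono a A' b =
    if a is e :: _ then if src e \in A then mono a A' b else 0
    else mono a (A `&` A') b.
Proof.
move=> gA gA'; rewrite /mono; case: a => [|e a] /=; first by rewrite -srM proj_setI.
by rewrite nmulA proj_s //; case: ifP; rewrite ?nmul0l.
Qed.

Lemma mono_proj A a A' b : gvset0 A -> gvset0 A' ->
  mono a A' b ** P A =
    if b is e :: _ then if src e \in A then mono a A' b else 0
    else mono a (A' `&` A) b.
Proof.
move=> gA gA'; rewrite /mono -slM; case: b => [|e b] /=; first by rewrite proj_setI.
by rewrite -nmulA s'_proj //; case: ifP; rewrite ?nmul0r ?sl0.
Qed.

Lemma s'_mono_nil e A b : gvset0 A ->
  s' e ** mono [::] A b = if src e \in A then mono [::] (rng e) (rcons b e) else 0.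
Proof.
move=> gA; rewrite /mono /= -srM s'_proj // /sr foldr_rcons (lf_rng_s' fam).
by case: ifP => // _; apply: sr0.
Qed.

Lemma s'_mono_cons e f a A b :
  s' e ** mono (f :: a) A b = if e == f then P (rng e) ** mono a A b else 0.
Proof. exact: s'_s. Qed.

Lemma s_mono e : s e = mono [:: e] (rng e) [::].
Proof. by rewrite /mono /= (lf_s_rng fam). Qed.

Lemma s'_mono e : s' e = mono [::] (rng e) [:: e].
Proof. by rewrite /mono /= (lf_rng_s' fam). Qed.

(** Formal combinations of monomials are kept as lists, so that they can later be
    sorted by degree. *)
Definition lcomb := seq (R * (seq E * gvset G * seq E)).

Definition lcomb_val (l : lcomb) : B :=
  \sum_(i <- l) i.1 *: mono i.2.1.1 (val i.2.1.2) i.2.2.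

Definition lspan y := exists l, y = lcomb_val l.

Lemma lspan0 : lspan 0.
Proof. by exists [::]; rewrite /lcomb_val big_nil. Qed.

Lemma lspanD y z : lspan y -> lspan z -> lspan (y + z).
Proof. by move=> [l ->] [l' ->]; exists (l ++ l'); rewrite /lcomb_val big_cat. Qed.

Lemma lspanZ k y : lspan y -> lspan (k *: y).
Proof.
move=> [l ->]; exists [seq (k * i.1, i.2) | i <- l].
by rewrite /lcomb_val big_map scaler_sumr; apply: eq_bigr => i _; rewrite scalerA.
Qed.

Lemma lspan_mono a A b : gvset0 A -> lspan (mono a A b).
Proof.
case=> [gA|->]; last first.
  by rewrite /mono extend0 sr0 sl0; apply: lspan0.
exists [:: (1, (a, SigSub (mem_set gA) : gvset G, b))].
by rewrite /lcomb_val big_seq1 scale1r.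
Qed.

Lemma lspan_mulr y : (forall a A b, gvset G A -> lspan (y ** mono a A b)) ->
  forall z, lspan z -> lspan (y ** z).
Proof.
move=> ym z [l ->]; rewrite /lcomb_val nmul_sumr.
elim: l => [|i l IHl]; first by rewrite big_nil; apply: lspan0.
rewrite big_cons; apply: lspanD => //; rewrite -scale_nmulAr.
by apply/lspanZ/ym; apply: set_valP.
Qed.

Lemma lspan_proj A z : gvset0 A -> lspan z -> lspan (P A ** z).
Proof.
move=> gA; apply: lspan_mulr => a A' b gA'; rewrite proj_mono //; last by left.
case: a => [|e a]; first by apply/lspan_mono/gvset0_setI => //; left.
by case: ifP => _; [apply: lspan_mono; left|apply: lspan0].
Qed.

Lemma lspan_s e z : lspan z -> lspan (s e ** z).
Proof.
apply: lspan_mulr => a A b gA.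
by rewrite -[_ ** _]/(mono (e :: a) A b); apply: lspan_mono; left.
Qed.

Lemma lspan_s' e z : lspan z -> lspan (s' e ** z).
Proof.
apply: lspan_mulr => -[|f a] A b gA.
  rewrite s'_mono_nil; last by left.
  by case: ifP => _; [apply: lspan_mono; left; apply: gvset_rng|apply: lspan0].
rewrite s'_mono_cons; case: ifP => _; last exact: lspan0.
by apply: lspan_proj; [left; apply: gvset_rng|apply: lspan_mono; left].
Qed.

End Monomials.

Section LeavittSpan.
Variables (R : comPzRingType) (G : ultragraph).
Local Notation L := (leavitt R G).
Local Notation span := (lspan (lpa_p R G) (lpa_s R G) (lpa_s' R G)).

(** The span contains the generators and is stable under left multiplication by
    them, hence contains every product of generators. *)
Lemma leavitt_span (x : L) : span x.
Proof.
have fam := lpa_family R G.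
elim/lclass_ind: x => t.
suff [] : span (lclass t) /\ forall z, span z -> span (lclass t ** z) by [].
elim: t => [A|e|e||t [st mt] u [su mu]|t [st mt]|k t [st mt]|t [st mt] u [su mu]].
- rewrite -[lclass _]/(lpa_p R G A) -(extend_val 0 (lpa_p R G)).
  have gA : gvset0 (val A) by left; apply: set_valP.
  split=> [|z]; [exact: (@lspan_mono _ _ _ _ _ _ [::] _ [::])|exact: lspan_proj].
- split=> [|z]; last exact: lspan_s.
  rewrite -[lclass _]/(lpa_s R G e) (s_mono fam); apply: lspan_mono.
  by left; apply: gvset_rng.
- split=> [|z]; last exact: lspan_s'.
  rewrite -[lclass _]/(lpa_s' R G e) (s'_mono fam); apply: lspan_mono.
  by left; apply: gvset_rng.
- by rewrite lclass0; split=> [|z _]; rewrite ?nmul0l; apply: lspan0.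
- rewrite lclassD; split=> [|z sz]; rewrite ?nmulDl; apply: lspanD => //.
    exact: mt.
  exact: mu.
- rewrite lclassN -scaleN1r.
  split=> [|z sz]; rewrite -?scale_nmulAl; apply: lspanZ => //.
  exact: mt.
- rewrite lclassZ; split=> [|z sz]; rewrite -?scale_nmulAl; apply: lspanZ => //.
  exact: mt.
- rewrite lclassM; split=> [|z sz]; first exact: mt.
  by rewrite -nmulA; apply/mt/mu.
Qed.

End LeavittSpan.

Section MonomialImage.
Variables (R : comPzRingType) (G : ultragraph).
Local Notation V := (vertex G).
Local Notation E := (edge G).
Local Notation X := (bpath G).
Local Notation F := (freegroup E).
Local Notation fct := (X -> R^o).
Local Notation M := (F -> fct).
Local Notation w := (@fg_word E).
Local Notation L := (leavitt R G).
Implicit Types (a b : seq E) (A : set V) (x y : L).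

Local Notation tr := (@transport_endo R G).
Local Notation restr := (@restrict_endo R G).
Local Notation lmono := (mono (lpa_p R G) (lpa_s R G) (lpa_s' R G)).

Definition rep : L -> endo M := leavitt_lift (@rep_p R G) (@rep_s R G) (@rep_s' R G).

Lemma rep_linear : linear rep.
Proof. exact: leavitt_lift_linear (@rep_family R G). Qed.

Lemma repM x y : rep (x ** y) = rep x ** rep y.
Proof. exact: leavitt_lift_mul (@rep_family R G) x y. Qed.

Lemma rep_lclass t : rep (lclass t) = leval (@rep_p R G) (@rep_s R G) (@rep_s' R G) t.
Proof. exact: leavitt_liftE (@rep_family R G) t. Qed.

Lemma repD x y : rep (x + y) = rep x + rep y.
Proof. by rewrite -[x]scale1r rep_linear !scale1r. Qed.

Lemma rep0 : rep 0 = 0.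
Proof. by apply: (addrI (rep 0)); rewrite -repD !addr0. Qed.

Lemma repZ k x : rep (k *: x) = k *: rep x.
Proof. by rewrite -[k *: x]addr0 rep_linear rep0 addr0. Qed.

Lemma rep_sum (I : Type) (l : seq I) (f : I -> L) :
  rep (\sum_(i <- l) f i) = \sum_(i <- l) rep (f i).
Proof. by elim/big_rec2: _ => [|i u v _ <-]; rewrite ?rep0 ?repD. Qed.

Lemma rep_p_ext A : gvset0 A -> rep (extend 0 (lpa_p R G) A) = restr (Xset A).
Proof.
case=> [gA|->]; last by rewrite extend0 rep0 Xset0 restr0.
rewrite -[A]/(val (SigSub (mem_set gA) : gvset G)) extend_val.
by rewrite /lpa_p rep_lclass.
Qed.

Lemma rep_sl a x : rep (sl (lpa_s R G) a x) = tr (w a) ** rep x.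
Proof.
elim: a => [|e a IHa] /=.
  by apply: endoP => m u z; rewrite fg_word_nil tr1 nmul_endoE restrE indic1 ?mul1r.
rewrite repM IHa nmulA /lpa_s rep_lclass /= tr_mul -fg_word_cons restr_tr //.
by move=> z; rewrite -cat1s -fg_word1; apply: Xword_prefix.
Qed.

Lemma rep_sr b x : rep (sr (lpa_s' R G) b x) = rep x ** tr (w b)^-1%g.
Proof.
elim: b => [|e b IHb] /=.
  apply: endoP => m u z; rewrite fg_word_nil invg1 tr1 nmul_endoE.
  by congr (endo_val (rep x) _ u z); apply/funext => u'; apply/funext => z';
    rewrite restrE indic1 ?mul1r.
rewrite repM IHb -nmulA /lpa_s' rep_lclass /= tr_mul -invgM -fg_word_cons restr_tr //.
by move=> z; rewrite -cat1s; apply: Xword_suffixV.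
Qed.

Lemma rep_mono a A b : gvset0 A ->
  rep (lmono a A b) = restr (Xposset a A) ** tr (w a * (w b)^-1)%g.
Proof.
move=> gA; rewrite rep_sl rep_sr rep_p_ext // nmulA.
rewrite (@tr_restr _ _ _ _ (Xposset a A)); last first.
  move=> x y [c [d [z [xE yE]]]].
  move=> h; have {}h : arrow (w a) x y by exists c, d, z.
  have /XwordP[u xE'] := arrowX h.
  have := set_valP x; rewrite /= xE' => /boundary_suffix bu.
  have : arrow (w a) x (SigSub (mem_set bu)).
    by exists a, [::], u; rewrite ucat0 fg_word_nil divg1.
  move=> /(arrow_fun h) ->; split=> [Au|]; first by apply/XpossetP; exists u.
  move=> /XpossetP[u' [E' Au']]; rewrite /Xset /=; suff -> : u = u' by [].
  by apply: (@ucat_inj _ a); rewrite -xE' -E'.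
rewrite -nmulA tr_mul nmulA restr_mul; congr (restr _ ** _).
apply/seteqP; split=> x; first by case.
move=> xa; split=> //; have /XpossetP[z [xE _]] := xa.
by apply/XwordP; exists z.
Qed.

End MonomialImage.

(** * The isomorphism onto the skew ring *)

Section Image.
Variables (R : comPzRingType) (G : ultragraph).
Local Notation V := (vertex G).
Local Notation E := (edge G).
Local Notation X := (bpath G).
Local Notation F := (freegroup E).
Local Notation fct := (X -> R^o).
Local Notation M := (F -> fct).
Local Notation w := (@fg_word E).
Local Notation L := (leavitt R G).
Implicit Types (a b : seq E) (A : set V) (x y : L) (t u : F) (m : M) (g : fct) (z : X).

Local Notation tr := (@transport_endo R G).
Local Notation restr := (@restrict_endo R G).
Local Notation lmono := (mono (lpa_p R G) (lpa_s R G) (lpa_s' R G)).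

Lemma beta_term t g g' z :
  beta t (beta t^-1%g g * g') z = if z \in Xfg t then g z * g' (theta t^-1%g z) else 0.
Proof.
rewrite /beta; case: ifP => // /set_mem/XfgP[z' zz'].
rewrite (thetaE zz') -[LHS]/((if z' \in Xfg t^-1%g then _ else _) * _).
rewrite mem_set; last exact: arrowX (arrowV zz').
by rewrite (thetaE (arrowV zz')).
Qed.

Lemma pskew_mulE (K : seq F) (f : M) m u z :
  uniq K -> (forall v, v \notin K -> f v = 0) ->
  pskew_mul f m u z = \sum_(v <- K) f v z * transport v m u z.
Proof.
move=> uK fK; have termE v : beta v (beta v^-1%g (f v) * m (v^-1 * u)%g) =
    (fun z' => f v z' * transport v m u z') :> fct.
  apply/funext => z'; rewrite beta_term /transport.
  by case: ifP; rewrite ?mulr0.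
rewrite /pskew_mul (eq_fsbigr _ _ (fun v _ => termE v)).
rewrite -(fsbig_widen [set` K] setT) //; last first.
  move=> v [_ /negP vK] /=; apply/funext => z'.
  by rewrite fK // mul0r.
by rewrite -fsbig_seq // fct_sumE.
Qed.

(** Since [theta_t] undoes [theta_t^-1], left multiplication by [g delta_t] is
    [transport t] followed by multiplication by [g]. *)
Lemma pskew_mul_sum (I : eqType) (l : seq I) (t : I -> F) (g : I -> fct) m u z :
  pskew_mul (\sum_(i <- l) delta (t i) (g i)) m u z =
    \sum_(i <- l) g i z * transport (t i) m u z.
Proof.
have sumE v z' : (\sum_(i <- l) delta (t i) (g i)) v z' = 
    \sum_(i <- l) if v == t i then g i z' else 0.
  by rewrite !fct_sumE; apply: eq_bigr => i _; rewrite /delta; case: ifP.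
rewrite (@pskew_mulE (undup [seq t i | i <- l])) ?undup_uniq //; last first.
  move=> v; rewrite mem_undup => vK; apply/funext => z'.
  rewrite sumE big_seq big1 // => i il; case: eqP => // E.
  by move: vK; rewrite E map_f.
under eq_bigr do rewrite sumE mulr_suml.
rewrite exchange_big /= [LHS]big_seq [RHS]big_seq; apply: eq_bigr => i il.
rewrite (bigD1_seq (t i)) ?undup_uniq ?mem_undup ?map_f //= eqxx.
by rewrite big1 ?addr0 // => v /negbTE ->; rewrite mul0r.
Qed.

(** Multiplying by this family on the right leaves the elements of the skew ring
    unchanged; it need not lie in the skew ring, which has no unit in general. *)
Definition unit_family : M := delta 1%g 1.

Definition phi0 x : M := rep x unit_family.

Lemma phi0D x y : phi0 (x + y) = phi0 x + phi0 y.
Proof. by rewrite /phi0 repD. Qed.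

Lemma phi00 : phi0 0 = 0.
Proof. by rewrite /phi0 rep0. Qed.

Lemma phi0Z k x : phi0 (k *: x) = k *: phi0 x.
Proof. by rewrite /phi0 repZ. Qed.

Lemma phi0_sum (I : Type) (l : seq I) (f : I -> L) :
  phi0 (\sum_(i <- l) f i) = \sum_(i <- l) phi0 (f i).
Proof. by elim/big_rec2: _ => [|i u v _ <-]; rewrite ?phi00 ?phi0D. Qed.

Lemma phi0M x y : phi0 (x ** y) = rep x (phi0 y).
Proof. by rewrite /phi0 repM. Qed.

Lemma deltaD t g h : delta t (g + h) = delta t g + delta t h.
Proof.
apply/funext => u; rewrite -[RHS]/(delta t g u + delta t h u) /delta.
by case: ifP; rewrite ?addr0.
Qed.

Lemma deltaZ t k g : delta t (k *: g) = k *: delta t g.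
Proof.
apply/funext => u; rewrite -[RHS]/(k *: delta t g u) /delta.
by case: ifP; rewrite ?scaler0.
Qed.

Lemma delta0 t : delta t 0 = 0 :> M.
Proof. by apply/funext => u; rewrite /delta; case: ifP. Qed.

Lemma transport_unit t : transport t unit_family = delta t \1_(Xfg t).
Proof.
apply/funext => u; apply/funext => z; rewrite /transport /unit_family /delta.
rewrite -(inj_eq (mulgI t)) mulVKg mulg1.
by case: (u == t); rewrite ?indicE; case: (z \in Xfg t).
Qed.

Lemma restrict_delta t (S : set X) g :
  restrict S (delta t g) = delta t (\1_S * g).
Proof.
apply/funext => u; apply/funext => z; rewrite /restrict /delta.
by case: ifP => _ //; rewrite mulr0.
Qed.

Lemma phi0_mono a A b : gvset0 A ->
  phi0 (lmono a A b) =
    delta (w a * (w b)^-1)%g (\1_(Xposset a A) * \1_(Xfg (w a * (w b)^-1)%g)).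
Proof.
by move=> gA; rewrite /phi0 rep_mono // nmul_endoE -restrict_delta -transport_unit.
Qed.

(** Both sides are linear in [x], and on a monomial both are a restriction after a
    transport. *)
Lemma rep_pskew_mul x m : rep x m = pskew_mul (phi0 x) m.
Proof.
have [l ->] := leavitt_span x; rewrite /lcomb_val rep_sum phi0_sum.
apply/funext => u; apply/funext => z; rewrite endo_sumE.
have gA (i : R * (seq E * gvset G * seq E)) : gvset0 (val i.2.1.2).
  by left; apply: set_valP.
under [in RHS]eq_bigr do rewrite phi0Z phi0_mono // -deltaZ.
rewrite pskew_mul_sum; apply: eq_bigr => i _.
rewrite repZ rep_mono //.
set t := (_ * _)%g; set S := Xposset _ _.
rewrite -[LHS]/(i.1 * (\1_S z * transport t m u z)).
rewrite -[X in _ = X * _]/(i.1 * (\1_S z * \1_(Xfg t) z)) -!mulrA.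
congr (_ * (_ * _)); rewrite /transport indicE.
by case: ifP => _; rewrite ?mul1r ?mulr0.
Qed.

Lemma phi0_mul x y : phi0 (x ** y) = pskew_mul (phi0 x) (phi0 y).
Proof. by rewrite phi0M rep_pskew_mul. Qed.

Lemma rep_delta x t g m u z : phi0 x = delta t g ->
  rep x m u z = g z * transport t m u z.
Proof.
move=> E; rewrite rep_pskew_mul E.
have := pskew_mul_sum [:: tt] (fun=> t) (fun=> g) m u z.
by rewrite !big_seq1.
Qed.

Lemma indic_set0 : \1_(set0 : set X) = 0 :> fct.
Proof. by apply/funext => z; rewrite indic_out. Qed.

Lemma indic_Xfg1 : \1_(Xfg 1%g) = 1 :> fct.
Proof. by apply/funext => z; rewrite indic1 //; apply: Xfg1. Qed.

Lemma Xposset_nil A : Xposset [::] A = Xset A.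
Proof.
apply/seteqP; split=> z; first by move=> /XpossetP[z' []]; rewrite ucat0 /Xset /= => ->.
by move=> Az; apply/XpossetP; exists (val z); rewrite ucat0.
Qed.

Lemma indic_Xposset a A : gvset G A ->
  (\1_(Xposset a A) : fct) = 0 \/ (@gensA R G `|` @gensbA R G) \1_(Xposset a A).
Proof.
move=> gA; have [->|aN] := eqVneq a [::].
  by right; left; exists A => //; rewrite Xposset_nil.
have [pa|npa] := pselect (fpath a); first by right; right; exists a => //; exists A.
left; rewrite -indic_set0; congr indic; apply/seteqP; split=> // z /XpossetP[z' [zE _]].
by apply: npa; have := set_valP z; rewrite /= zE => /(boundary_ucat _ aN)[].
Qed.

Lemma smallest_gen (U : Type) (C : set U -> Prop) (S : set U) : S `<=` smallest C S.
Proof. by move=> f Sf N [_]; apply. Qed.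

Lemma Dideal_mono a A b : gvset G A ->
  Dideal (w a * (w b)^-1)%g
    (\1_(Xposset a A) * \1_(Xfg (w a * (w b)^-1)%g) : fct).
Proof.
move=> gA; set t := (_ * _)%g; have [D0 _ _] := @Dideal_submodule R G t.
have [->|gens] := indic_Xposset a gA; first by rewrite mul0r.
rewrite /Dideal; case: eqVneq => [->|t1].
  by rewrite indic_Xfg1 mulr1; apply: smallest_gen; left.
by apply: smallest_gen; exists \1_(Xposset a A); [left|rewrite mulrC].
Qed.

Lemma pskew_set_delta t g : Dideal t g -> pskew_set (delta t g).
Proof.
move=> Dg; split=> [u|].
  by rewrite /delta; case: eqP => [->//|_]; have [] := @Dideal_submodule R G u.
apply: (@sub_finite_set _ _ [set t]); last exact: finite_set1.
by move=> u /=; rewrite /delta; case: (eqVneq u t) => // _; rewrite eqxx.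
Qed.

Lemma pskew_set_phi0 x : pskew_set (phi0 x).
Proof.
have [S0 SD SZ] := @pskew_submodule R G.
have [l ->] := leavitt_span x; rewrite /lcomb_val phi0_sum.
elim/big_rec: _ => // i f _ Sf; apply: SD => //; rewrite phi0Z; apply: SZ.
have gA : gvset G (val i.2.1.2) := set_valP _.
rewrite phi0_mono; last by left.
exact/pskew_set_delta/Dideal_mono.
Qed.

(** ** Surjectivity *)

Definition phi0_hits t g : Prop := exists x, phi0 x = delta t g.

Lemma phi0_hits_submodule t : is_submodule (phi0_hits t).
Proof.
split=> [|g h [x xE] [y yE]|k g [x xE]].
- by exists 0; rewrite phi00 delta0.
- by exists (x + y); rewrite phi0D xE yE deltaD.
- by exists (k *: x); rewrite phi0Z xE deltaZ.
Qed.

Lemma phi0_hits_mul t g h : phi0_hits 1%g g -> phi0_hits t h -> phi0_hits t (g * h).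
Proof.
move=> [x xE] [y yE]; exists (x ** y); rewrite phi0M yE.
apply/funext => u; apply/funext => z.
rewrite (rep_delta _ _ _ xE) (transport_arrow _ _ (arrow1 z)) invg1 mul1g /delta.
by case: ifP => // _; rewrite mulr0.
Qed.

(** When [t = a b^-1] is reduced, every point of [X_t] is [a] followed by a path
    that starts in the ranges of [a] and [b], so that [s_a p_A s_b^*], for [A] the
    intersection of these ranges, acts as all of [1_t delta_t]. *)
Lemma phi0_hits_Xfg t : t != 1%g -> phi0_hits t \1_(Xfg t).
Proof.
move=> t1; have [|nX] := pselect (exists z, Xfg t z); last first.
  exists 0; rewrite phi00 (_ : Xfg t = set0) ?indic_set0 ?delta0 //.
  by apply/seteqP; split=> // z tz; apply: nX; exists z.
move=> [z /XfgP[y [a [b [v [_ _ E]]]]]].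
have [a0 [b0 [c [aE bE u]]]] := unlinked_root a b.
have {E aE bE}E : t = (w a0 * (w b0)^-1)%g.
  by rewrite E aE bE !fg_word_cat invgM !mulgA mulgK.
(* The range of a word, with no condition for the empty word. *)
pose full d : set V := if d is [::] then setT else path_rng d.
have gfull d : d != [::] -> gvset G (full d).
  case/lastP: d => // d e _; rewrite (_ : full _ = rng e); first exact: gvset_rng.
  rewrite -[RHS]/(if Some e is Some e' then rng e' else set0) -(last_edge_rcons d).
  by rewrite /full; case: (d).
have g : gvset0 (full a0 `&` full b0).
  have [a00|aN] := eqVneq a0 [::]; have [b00|bN] := eqVneq b0 [::].
  - by move: t1; rewrite E a00 b00 mulgV eqxx.
  - by rewrite {1}a00 setTI; left; apply: gfull.
  - by rewrite {1}b00 setIT; left; apply: gfull.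
  - by apply: gvset0_setI; left; apply: gfull.
exists (lmono a0 (full a0 `&` full b0) b0).
rewrite phi0_mono // -E; congr delta; apply/funext => x.
rewrite -[LHS]/(\1_(Xposset a0 (full a0 `&` full b0)) x * \1_(Xfg t) x) -indicI.
congr (\1_ _ x); apply/seteqP; split=> [x' []//|x' tx]; split=> //.
move: tx; rewrite E => /(Xfg_unlinked u)[v' [xE bv']]; apply/XpossetP; exists v'.
have fullP d : boundary (ucat d v') -> full d (usrc v').
  by rewrite /full; case: d => // e d /(@boundary_ucat _ (e :: d))[].
split=> //; split; apply: fullP => //.
by have := set_valP x'; rewrite /= xE.
Qed.

(** The functions [1_c] come from [1_c delta_c * 1_(c^-1) delta_(c^-1)]. *)
Lemma phi0_hits_gens g :
  (@gensA R G `|` @gensbA R G `|` @gens_fg R G [set c | c != 1%g]) g ->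
  phi0_hits 1%g g.
Proof.
case=> [[[A gA <-]|[b pb [A gA <-]]]|[c /= c1 <-]].
- exists (lmono [::] A [::]); rewrite phi0_mono; last by left.
  by rewrite Xposset_nil mulgV indic_Xfg1 mulr1.
- exists (lmono b A b); rewrite phi0_mono; last by left.
  by rewrite mulgV indic_Xfg1 mulr1.
have [x xE] := phi0_hits_Xfg c1.
have [y yE] : phi0_hits c^-1%g \1_(Xfg c^-1%g).
  by apply: phi0_hits_Xfg; rewrite invg_eq1.
exists (x ** y); rewrite phi0M yE; apply/funext => u; apply/funext => z.
rewrite (rep_delta _ _ _ xE).
have [/XfgP[z' zz']|nz] := pselect (Xfg c z); last first.
  by rewrite /delta transport_out // mulr0; case: ifP; rewrite ?indic_out.
rewrite (transport_arrow _ _ zz') /delta -{2}[c^-1%g]mulg1 (inj_eq (mulgI _)).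
rewrite indic1 ?mul1r; last exact: arrowX zz'.
case: ifP => // _; rewrite !indic1 //; first exact: arrowX zz'.
exact: arrowX (arrowV zz').
Qed.

Lemma Dideal_hits t g : Dideal t g -> phi0_hits t g.
Proof.
rewrite /Dideal; case: eqVneq => [->|t1] h.
  apply: (h (phi0_hits 1%g)); split; last exact: phi0_hits_gens.
  by split=> [|f f'] ; [exact: phi0_hits_submodule|exact: phi0_hits_mul].
apply: (h (phi0_hits t)); split; first exact: phi0_hits_submodule.
move=> _ [f gf <-]; have ht := phi0_hits_Xfg t1.
have [->|f1] := eqVneq f 1; first by rewrite mulr1.
rewrite mulrC; apply: phi0_hits_mul => //; apply: phi0_hits_gens.
case: gf => [gf|[c _ cE]]; [by left|right; exists c => //=].
by apply: contra_neq f1 => c1; rewrite -cE c1 indic_Xfg1.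
Qed.

Lemma phi0_surj m : pskew_set m -> exists x, phi0 x = m.
Proof.
move=> [Dm /finite_seqP[K KE]].
have /choice[x xE] : forall t, exists x, phi0 x = delta t (m t).
  by move=> t; apply/Dideal_hits/Dm.
exists (\sum_(t <- undup K) x t); rewrite phi0_sum; apply/funext => u.
under eq_bigr do rewrite xE.
rewrite fct_sumE; have [uK|uK] := boolP (u \in undup K).
  rewrite (bigD1_seq u) ?undup_uniq //= big1 ?addr0 /delta ?eqxx //.
  by move=> v vu; rewrite eq_sym (negbTE vu).
rewrite big_seq big1; last first.
  by move=> v vK; rewrite /delta; case: eqP => // uv; rewrite uv vK in uK.
apply/esym/eqP/negPn/negP => mu.
by have : [set t | m t != 0] u by []; rewrite KE /= -mem_undup (negbTE uK).
Qed.

End Image.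

(** * Injectivity *)

Section Projections.
Variables (R : comPzRingType) (G : ultragraph) (B : nuAlgType R).
Local Notation V := (vertex G).
Local Notation E := (edge G).
Variables (p : gvset G -> B) (s s' : E -> B).
Hypothesis fam : leavitt_family p s s'.
Local Notation P := (extend 0 p).
Implicit Types (A C D : set V) (l : seq (R * gvset G)).

Definition comb_at l (v : V) : R := \sum_(i <- l) i.1 * \1_(val i.2) v.

(** A statement about [C] minus [D] can be split along the first set [A] of the
    combination: inside [A] its projection acts as 1 and its coefficient joins the
    constant [c], outside [A] it acts as 0. *)
Lemma proj_diff_comb l (c : R) C D : gvset0 C -> gvset0 D ->
  (forall v, C v -> ~ D v -> c + comb_at l v = 0) ->
  c *: (P C - P (C `&` D)) +
    (\sum_(i <- l) i.1 *: P (val i.2)) ** (P C - P (C `&` D)) = 0.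
Proof.
elim: l c C D => [|[r A] l IHl] c C D gC gD h; rewrite /comb_at.
  rewrite big_nil nmul0l addr0.
  have [CD|/existsNP[v /not_implyP[Cv Dv]]] := pselect (C `<=` D).
    by rewrite (setIidl CD) subrr scaler0.
  by have := h v Cv Dv; rewrite /comb_at big_nil addr0 => ->; rewrite scale0r.
have gA : gvset0 (val A) by left; apply: set_valP.
have gI := gvset0_setI; have gU := gvset0_setU.
pose A' := val A.
have split1 : P C - P (C `&` D) =
    (P (C `&` A') - P (C `&` A' `&` D)) + (P C - P (C `&` (D `|` A'))).
  rewrite setIUr (proj_setU fam (gI _ _ _ gC gD) (gI _ _ _ gC gA)).
  rewrite (_ : C `&` D `&` (C `&` A') = C `&` A' `&` D); last first.
    by apply/seteqP; split=> v /=; tauto.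
  rewrite -[_ + _ - _]addrA; move: (P (C `&` A') - _) => k.
  by rewrite opprD [RHS]addrC -[RHS]addrA subrK.
set d1 := P (C `&` A') - _ in split1; set d2 := P C - P (C `&` (D `|` A')) in split1.
have Ad1 : P A' ** d1 = d1.
  have g1 : gvset0 (C `&` A') by apply: gI.
  have g2 : gvset0 (C `&` A' `&` D) by apply: gI.
  rewrite nmulDr nmulNr !(proj_setI fam) //.
  by congr (P _ - P _); apply/seteqP; split=> v /=; tauto.
have Ad2 : P A' ** d2 = 0.
  have g1 : gvset0 (C `&` (D `|` A')) by apply/gI => //; apply: gU.
  rewrite nmulDr nmulNr !(proj_setI fam) //.
  rewrite (_ : A' `&` (C `&` (D `|` A')) = A' `&` C) ?subrr //.
  by apply/seteqP; split=> v /=; tauto.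
have h1 : (c + r) *: d1 + (\sum_(i <- l) i.1 *: P (val i.2)) ** d1 = 0.
  apply: IHl => //; first exact: gI.
  move=> v [Cv Av] Dv; have := h v Cv Dv.
  by rewrite /comb_at big_cons /= indicE mem_set // mulr1 addrA.
have h2 : c *: d2 + (\sum_(i <- l) i.1 *: P (val i.2)) ** d2 = 0.
  apply: IHl => //; first exact: gU.
  move=> v Cv /not_orP[Dv Av]; have := h v Cv Dv.
  by rewrite /comb_at big_cons /= indicE memNset // mulr0 add0r.
rewrite split1 big_cons /= nmulDl -scale_nmulAl nmulDr Ad1 Ad2 addr0.
rewrite scalerDr nmulDr [r *: d1 + _]addrA addrACA [c *: d1 + _]addrA -scalerDl.
by rewrite h1 h2 addr0.
Qed.

(** The projection of the union of all the sets that occur fixes the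
    combination. *)
Lemma proj_comb0 l : (forall v, comb_at l v = 0) ->
  \sum_(i <- l) i.1 *: P (val i.2) = 0.
Proof.
move=> h; pose C := \big[setU/set0]_(i <- l) (val i.2 : set V).
have gC : gvset0 C.
  rewrite /C; elim/big_rec: _ => [|i A _ gA]; first by right.
  by apply: gvset0_setU => //; left; apply: set_valP.
have := @proj_diff_comb l 0 C set0 gC (or_intror erefl).
rewrite setI0 extend0 subr0 scale0r add0r => C0.
rewrite -[RHS]C0; last by move=> v _ _; rewrite add0r.
rewrite nmul_suml big_seq [RHS]big_seq; apply: eq_bigr => i il.
rewrite -scale_nmulAl (proj_setI fam) //; last by left; apply: set_valP.
congr (_ *: P _); apply/esym/setIidl => v iv.
by rewrite /C (big_rem i) //=; left.
Qed.

End Projections.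

Section Diagonal.
Variables (R : comPzRingType) (G : ultragraph) (B : nuAlgType R).
Local Notation V := (vertex G).
Local Notation E := (edge G).
Variables (p : gvset G -> B) (s s' : E -> B).
Hypothesis fam : leavitt_family p s s'.
Local Notation P := (extend 0 p).
Local Notation mono := (mono p s s').
Implicit Types (A : set V) (c : seq E) (e f : E) (l : seq (R * (seq E * gvset G))).

Definition diag_term (i : seq E * gvset G) := mono i.1 (val i.2) i.1.

(** The bound is strict, so that the span is 0 at [n = 0], where inductions on
    [n] start. *)
Definition diag_span n y := exists l,
  all (fun i => size i.2.1 < n)%N l /\ y = \sum_(i <- l) i.1 *: diag_term i.2.

Lemma diag_span0 n : diag_span n 0.
Proof. by exists [::]; rewrite big_nil. Qed.

Lemma diag_spanD n y z : diag_span n y -> diag_span n z -> diag_span n (y + z).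
Proof.
move=> [l [ln ->]] [l' [ln' ->]]; exists (l ++ l').
by rewrite all_cat ln ln' big_cat.
Qed.

Lemma diag_spanZ n k y : diag_span n y -> diag_span n (k *: y).
Proof.
move=> [l [ln ->]]; exists [seq (k * i.1, i.2) | i <- l]; rewrite all_map.
by split=> //; rewrite big_map scaler_sumr; apply: eq_bigr => i _; rewrite scalerA.
Qed.

Lemma diag_span_le n n' y : (n <= n')%N -> diag_span n y -> diag_span n' y.
Proof.
move=> nn' [l [ln ->]]; exists l; split=> //.
by apply: sub_all ln => i li; apply: leq_trans li nn'.
Qed.

Lemma diag_span_mono n c A : gvset0 A -> (size c < n)%N -> diag_span n (mono c A c).
Proof.
case=> [gA|->] cn; last first.
  by rewrite /mono extend0 sr0 sl0; apply: diag_span0.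
exists [:: (1, (c, SigSub (mem_set gA) : gvset G))].
by rewrite /= cn big_seq1 scale1r.
Qed.

Lemma diag_span_sum n (I : eqType) (l : seq I) (k : I -> R) (y : I -> B) :
  (forall i, i \in l -> diag_span n (y i)) ->
  diag_span n (\sum_(i <- l) k i *: y i).
Proof.
elim: l => [|i l IHl] h; first by rewrite big_nil; apply: diag_span0.
rewrite big_cons; apply: diag_spanD; first by apply/diag_spanZ/h/mem_head.
by apply: IHl => j jl; apply: h; rewrite in_cons jl orbT.
Qed.

Lemma diag_span_pl n A y : gvset0 A -> diag_span n y -> diag_span n (P A ** y).
Proof.
move=> gA [l [/allP ln ->]]; rewrite nmul_sumr.
under eq_bigr do rewrite -scale_nmulAr.
apply: diag_span_sum => -[k [c A']] /ln /= cn.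
have gA' : gvset0 (val A') by left; apply: set_valP.
rewrite /diag_term (proj_mono fam) //=; case: c cn => [|e c] cn.
  by apply: diag_span_mono => //; apply: gvset0_setI.
by case: ifP => _; [apply: diag_span_mono|apply: diag_span0].
Qed.

Lemma diag_span_pr n A y : gvset0 A -> diag_span n y -> diag_span n (y ** P A).
Proof.
move=> gA [l [/allP ln ->]]; rewrite nmul_suml.
under eq_bigr do rewrite -scale_nmulAl.
apply: diag_span_sum => -[k [c A']] /ln /= cn.
have gA' : gvset0 (val A') by left; apply: set_valP.
rewrite /diag_term (mono_proj fam) //=; case: c cn => [|e c] cn.
  by apply: diag_span_mono => //; apply: gvset0_setI.
by case: ifP => _; [apply: diag_span_mono|apply: diag_span0].
Qed.

Lemma gvset0_rng e : gvset0 (rng e).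
Proof. by left; apply: gvset_rng. Qed.

(** The induction on the length of words rests on this: words that start with [e]
    lose that letter, and empty words stay empty. *)
Lemma diag_span_compress n e y : (0 < n)%N -> diag_span n.+1 y ->
  diag_span n (s' e ** y ** s e).
Proof.
move=> n0 [l [/allP ln ->]]; rewrite nmul_sumr nmul_suml.
under eq_bigr do rewrite -scale_nmulAr -scale_nmulAl.
apply: diag_span_sum => -[k [c A]] /ln /= cn.
have gA : gvset0 (val A) by left; apply: set_valP.
rewrite /diag_term; case: c cn => [|f c] cn.
  rewrite -[mono _ _ _]/(P (val A)) (s'_proj fam) //; case: ifP => _.
    by rewrite (lf_s's_eq fam); apply: (@diag_span_mono _ [::]) => //; apply: gvset0_rng.
  by rewrite nmul0l; apply: diag_span0.
rewrite -[mono _ _ _]/(s f ** sl s c (sr s' c (P (val A)) ** s' f)) slM.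
rewrite (s'_s fam); case: eqVneq => [<-|_]; last by rewrite nmul0l; apply: diag_span0.
rewrite nmulA (s_s' fam) eqxx.
by apply/diag_span_pr/diag_span_pl/diag_span_mono => //; apply: gvset0_rng.
Qed.

Lemma range_proj_diag e c (A : gvset G) :
  (s e ** s' e) ** diag_term (c, A) =
    if c is f :: _ then if e == f then diag_term (c, A) else 0
    else \1_(val A) (src e) *: (s e ** s' e).
Proof.
rewrite /diag_term /=; case: c => [|f c].
  rewrite -[mono _ _ _]/(P (val A)) -nmulA (s'_proj fam); last by left; apply: set_valP.
  by rewrite indicE; case: ifP; rewrite ?scale1r // nmul0r scale0r.
rewrite -[mono _ _ _]/(s f ** sl s c (sr s' (f :: c) (P (val A)))) -nmulA (s'_s fam).
case: eqVneq => [<-|_]; last by rewrite nmul0r.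
by rewrite nmulA (lf_s_rng fam).
Qed.

Lemma diag_range_proj e c (A : gvset G) :
  diag_term (c, A) ** (s e ** s' e) = (s e ** s' e) ** diag_term (c, A).
Proof.
rewrite range_proj_diag /diag_term /=; case: c => [|f c].
  rewrite -[mono _ _ _]/(P (val A)) nmulA (proj_s fam); last by left; apply: set_valP.
  by rewrite indicE; case: ifP; rewrite ?scale1r // nmul0l scale0r.
rewrite -[mono _ _ _]/(sl s (f :: c) (sr s' c (P (val A)) ** s' f)) slM nmulA (s_s' fam).
rewrite eq_sym; case: eqVneq => [<-|_]; last by rewrite nmul0l.
by rewrite -nmulA (lf_rng_s' fam).
Qed.

Lemma range_proj_idem e : (s e ** s' e) ** (s e ** s' e) = s e ** s' e.
Proof. by rewrite nmulA -[s e ** s' e ** s e]nmulA (lf_s's_eq fam) (lf_s_rng fam). Qed.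

(** The range projection [s_e s_e^*] is idempotent and commutes with diagonal
    elements. *)
Lemma range_proj0 e l : s' e ** (\sum_(i <- l) i.1 *: diag_term i.2) ** s e = 0 ->
  (s e ** s' e) ** (\sum_(i <- l) i.1 *: diag_term i.2) = 0.
Proof.
set y := \sum_(i <- l) _ => h.
have comm : y ** (s e ** s' e) = (s e ** s' e) ** y.
  rewrite nmul_suml nmul_sumr; apply: eq_bigr => -[k [c A]] _.
  by rewrite -scale_nmulAl -scale_nmulAr diag_range_proj.
rewrite -range_proj_idem -nmulA -comm.
have -> : (s e ** s' e) ** (y ** (s e ** s' e)) = s e ** (s' e ** y ** s e) ** s' e.
  by rewrite !nmulA.
by rewrite h nmul0r nmul0l.
Qed.

Definition vertex_part l (v : V) : R :=
  \sum_(i <- l | i.2.1 == [::]) i.1 * \1_(val i.2.2) v.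

Lemma range_proj_sum e l :
  (s e ** s' e) ** (\sum_(i <- l) i.1 *: diag_term i.2) =
  vertex_part l (src e) *: (s e ** s' e) +
  \sum_(i <- l | ohead i.2.1 == Some e) i.1 *: diag_term i.2.
Proof.
rewrite /vertex_part scaler_suml nmul_sumr [in RHS]big_mkcond.
rewrite [X in _ + X]big_mkcond -big_split /=.
apply: eq_bigr => -[k [c A]] _ /=; rewrite -scale_nmulAr range_proj_diag.
case: c => [|f c] /=; first by rewrite scalerA addr0.
rewrite add0r -[Some f == _]/(f == e) eq_sym.
by case: ifP => // _; rewrite scaler0.
Qed.

Definition first_edges l : seq E := undup (pmap (fun i => ohead i.2.1) l).

(** Let [F] be the set of first edges and [f] the vertex function.  Multiplying by
    the range projections of the edges in [F] shows that the terms with nonempty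
    words add up to minus the sum of the [f (src e) s_e s_e^*].  The support of
    [f] is a finite set of vertices that emit finitely many edges, all in [F], so
    the terms with empty words add up to the sum of the [f v p_v], and the
    Cuntz-Krieger relation makes the two cancel. *)
Lemma diag0_of_compress l :
  (forall e, e \in first_edges l ->
     s' e ** (\sum_(i <- l) i.1 *: diag_term i.2) ** s e = 0) ->
  (forall v, vertex_part l v != 0 ->
     ~ sink v /\ forall e, src e = v -> e \in first_edges l) ->
  \sum_(i <- l) i.1 *: diag_term i.2 = 0.
Proof.
move=> compr0 supp; set F := first_edges l in compr0 supp.
have uF : uniq F by apply: undup_uniq.
set f := vertex_part l in supp.
pose U := undup [seq src e | e <- F].
have inU v : f v != 0 -> v \in U.
  move=> /supp[ns al]; move/existsNP: ns => [e /negP/negPn/eqP ev].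
  by rewrite mem_undup -ev map_f // al.
have tailE : \sum_(i <- l | i.2.1 != [::]) i.1 *: diag_term i.2 =
    - \sum_(e <- F) f (src e) *: (s e ** s' e).
  apply/eqP; rewrite -addr_eq0; apply/eqP.
  rewrite (_ : \sum_(i <- l | _) _ =
    \sum_(e <- F) \sum_(i <- l | ohead i.2.1 == Some e) i.1 *: diag_term i.2).
    rewrite -big_split big_seq big1 //= => e eF.
    by rewrite addrC -range_proj_sum range_proj0 // compr0.
  rewrite (exchange_big_dep (fun i => i.2.1 != [::])) /=; last first.
    by move=> e [k [[|g c] A]].
  rewrite big_seq_cond [RHS]big_seq_cond; apply: eq_bigr => -[k [c A]] /= /andP[il cN].
  case: c cN il => // g c _ il; have gF : g \in F.
    by rewrite mem_undup mem_pmap; apply/mapP; exists (k, (g :: c, A)).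
  rewrite [RHS]big_mkcond (bigD1_seq g) //= eqxx big1 ?addr0 // => e /negbTE eg.
  by rewrite -[Some g == _]/(g == e) eq_sym eg.
have headE : \sum_(i <- l | i.2.1 == [::]) i.1 *: diag_term i.2 =
    \sum_(v <- U) f v *: P [set v].
  pose l1 : seq (R * gvset G) := [seq (i.1, i.2.2) | i <- l & i.2.1 == [::]] ++
    [seq (- f v, SigSub (mem_set (gvset_set1 v)) : gvset G) | v <- U].
  have := @proj_comb0 _ _ _ _ _ _ fam l1.
  rewrite /l1 big_cat /= !big_map big_filter /= => E.
  apply/eqP; rewrite -subr_eq0 -sumrN -[X in _ == X]E.
    apply/eqP; congr (_ + _); last by apply: eq_bigr => v _; rewrite scaleNr.
    by apply: eq_bigr => -[k [c A]] /eqP /= ->.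
  move=> v; rewrite /comb_at big_cat /= !big_map big_filter /= -/(vertex_part l v) -/f.
  have [vU|vU] := boolP (v \in U).
    rewrite (bigD1_seq v) ?undup_uniq //= indicE mem_set // mulr1.
    rewrite big1 ?addr0 ?subrr // => u uv; rewrite indicE memNset ?mulr0 // => vu.
    by rewrite vu eqxx in uv.
  rewrite big_seq big1 ?addr0; first by apply/eqP/negPn/negP => /inU; apply/negP.
  by move=> u uU; rewrite indicE memNset ?mulr0 // => vu; rewrite vu uU in vU.
have ckE v : v \in U ->
    f v *: P [set v] = f v *: \sum_(e <- F | src e == v) s e ** s' e.
  move=> vU; have [->|/supp[ns al]] := eqVneq (f v) 0; first by rewrite !scale0r.
  congr (_ *: _); rewrite -big_filter; apply: (lf_ck fam).
  - exact: filter_uniq.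
  - move: ns => /existsNP[e /negP/negPn/eqP ev]; apply/eqP => E0.
    have : e \in [seq e <- F | src e == v] by rewrite mem_filter ev eqxx al.
    by rewrite E0.
  - move=> e; rewrite mem_filter; case: eqVneq => // ev; exact: al.
rewrite (bigID (fun i => i.2.1 == [::])) /= headE tailE.
apply/eqP; rewrite subr_eq0; apply/eqP.
rewrite big_seq; under eq_bigr => v vU do rewrite ckE // scaler_sumr.
rewrite -big_seq (exchange_big_dep predT) //= [LHS]big_seq [RHS]big_seq.
apply: eq_bigr => e eF.
rewrite big_mkcond (bigD1_seq (src e)) ?undup_uniq ?mem_undup ?map_f //= eqxx.
by rewrite big1 ?addr0 // => v /negbTE; rewrite eq_sym => ->.
Qed.

End Diagonal.

Section Injectivity.
Variables (R : comPzRingType) (G : ultragraph).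
Local Notation V := (vertex G).
Local Notation E := (edge G).
Local Notation X := (bpath G).
Local Notation F := (freegroup E).
Local Notation fct := (X -> R^o).
Local Notation M := (F -> fct).
Local Notation w := (@fg_word E).
Local Notation L := (leavitt R G).
Local Notation p := (lpa_p R G).
Local Notation s := (lpa_s R G).
Local Notation s' := (lpa_s' R G).
Local Notation lmono := (mono p s s').
Local Notation P := (extend 0 p).
Local Notation fam := (lpa_family R G).
Local Notation dspan := (diag_span p s s').
Local Notation lval := (lcomb_val p s s').
Implicit Types (a b c : seq E) (A : set V) (x y : L) (t u : F) (z : X).

Lemma phi0_eq0 x : phi0 x = 0 -> rep x = 0.
Proof.
move=> x0; apply: endoP => m u z.
by rewrite rep_pskew_mul x0 -(@phi00 R G) -rep_pskew_mul rep0.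
Qed.

Lemma phi0_diag_sum (l : seq (R * (seq E * gvset G))) z :
  (forall e (r : upath G), val z = ucat [:: e] r -> e \notin first_edges l) ->
  phi0 (\sum_(i <- l) i.1 *: diag_term p s s' i.2) 1%g z =
    vertex_part l (usrc (val z)).
Proof.
move=> zF; rewrite phi0_sum !fct_sumE /vertex_part [RHS]big_mkcond.
rewrite big_seq [RHS]big_seq; apply: eq_bigr => -[k [c A]] il.
rewrite phi0Z phi0_mono; last by left; apply: set_valP.
rewrite /= mulgV indic_Xfg1 mulr1 -[LHS]/(k * \1_(Xposset c (val A)) z).
case: c il => [|e c] il /=; first by rewrite Xposset_nil indicE.
rewrite indic_out ?mulr0 // => /XpossetP[z' [zE _]].
have := zF e (ucat c z'); rewrite -ucat_cat => /(_ zE); apply/negP/negPn.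
by rewrite mem_undup mem_pmap; apply/mapP; exists (k, (e :: c, A)).
Qed.

(** Evaluating at a boundary path of length 0, or whose first edge starts none
    of the words, leaves only the vertex function; this is where it matters that
    boundary paths start at every vertex. *)
Lemma rep_diag_inj n y : dspan n y -> rep y = 0 -> y = 0.
Proof.
elim: n y => [|n IHn] y yn y0.
  have [[|i l] [ln ->]] := yn; first by rewrite big_nil.
  by case/andP: ln.
have [l [/allP ln yE]] := yn; have y0' := y0; rewrite yE in y0'.
have phi_y : phi0 y = 0 by rewrite /phi0 y0.
rewrite yE; apply: (diag0_of_compress fam).
  move=> e; rewrite mem_undup mem_pmap => /mapP[[k [c A]] /ln /= cn ec].
  have n0 : (0 < n)%N.
    by case: c cn ec => [|f c] //= + _; rewrite ltnS; apply: leq_trans.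
  rewrite -yE; apply: IHn; first exact: (diag_span_compress fam).
  by rewrite !repM y0 nmul0r nmul0l.
move=> v; have eval z : usrc (val z) = v ->
    (forall e (r : upath G), val z = ucat [:: e] r -> e \notin first_edges l) ->
    vertex_part l v = 0.
  by move=> <- zF; rewrite -phi0_diag_sum // -yE phi_y.
move=> lv; split=> [sv|e ev]; last first.
  apply: contraNT lv => eF; apply/eqP.
  have [v' rv'] := rng_neq0 e; have [z [bz zv']] := boundary_at v'.
  have bez : boundary (ucat [:: e] z) by apply/boundary_ucat_cons; rewrite zv'.
  apply: (eval (SigSub (mem_set bez))); first by rewrite usrc_ucat_cons.
  by move=> f z' /ucat1_inj <-.
have bv : boundary (UFin [::] v) by split=> //; left.
by move/eqP: lv; apply; apply: (eval (SigSub (mem_set bv))) => // e [].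
Qed.

Lemma sr_proj n A b y : gvset0 A -> dspan n y ->
  exists2 y', dspan n y' & sr s' b y ** P A = sr s' b y'.
Proof.
move=> gA ny; case: b => [|f b] /=.
  by exists (y ** P A) => //; apply: (diag_span_pr fam).
rewrite -nmulA (s'_proj fam) //; case: ifP => _; first by exists y.
by exists 0; [apply: diag_span0|rewrite sr0 nmul0l nmul0r].
Qed.

Lemma proj_sl n A a b y : gvset0 A -> dspan n y ->
  exists2 y', dspan n y' & P A ** sl s a (sr s' b y) = sl s a (sr s' b y').
Proof.
move=> gA ny; case: a => [|f a] /=.
  by exists (P A ** y); [apply: (diag_span_pl fam)|rewrite srM].
rewrite nmulA (proj_s fam) //; case: ifP => _; first by exists y.
by exists 0; [apply: diag_span0|rewrite sr0 sl0 nmul0r nmul0l].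
Qed.

(** The words can be stripped off one letter at a time: multiplying [s_e z] by
    [s_e^*] on the left gives [p_A z] with [A] the range of [e], which has the
    same shape as [z], and [s_e (p_A z)] is [s_e z]. *)
Lemma rep_corner_inj n a b y : dspan n y ->
  rep (sl s a (sr s' b y)) = 0 -> sl s a (sr s' b y) = 0.
Proof.
elim: a y => [|e a IHa] y ny.
  elim: b y ny => [|e b IHb] y ny; first exact: rep_diag_inj ny.
  have [y' ny' yE] := sr_proj b (gvset0_rng e) ny.
  rewrite /= => y0; rewrite -(lf_rng_s' fam) nmulA yE [sr _ _ y']IHb ?nmul0l //.
  have := congr1 (fun f => f ** rep (s e)) y0; rewrite nmul0l -repM (s_s' fam) eqxx.
  by rewrite yE.
have [y' ny' yE] := proj_sl a b (gvset0_rng e) ny.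
rewrite /= => y0; rewrite -(lf_s_rng fam) -nmulA yE IHa ?nmul0r //.
have := congr1 (fun f => rep (s' e) ** f) y0; rewrite nmul0r -repM (s'_s fam) eqxx.
by rewrite yE.
Qed.

Definition degree (i : R * (seq E * gvset G * seq E)) : F :=
  (w i.2.1.1 * (w i.2.2)^-1)%g.

(** Words of the same degree come from one reduced pair [(a0, b0)] by appending a
    common suffix, so that the combination is [s_a0 y s_b0^*] with [y] diagonal. *)
Lemma rep_homogeneous_inj t (l : lcomb R G) :
  {in l, forall i, degree i = t} -> rep (lval l) = 0 -> lval l = 0.
Proof.
case: l => [|i0 l0]; first by rewrite /lcomb_val big_nil.
set l := i0 :: l0 => lt.
have [a0 [b0 [c0 [aE bE u]]]] := unlinked_root i0.2.1.1 i0.2.2.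
have tE : t = (w a0 * (w b0)^-1)%g.
  by rewrite -(lt i0) ?mem_head // /degree aE bE !fg_word_cat invgM !mulgA mulgK.
have mE i : i \in l -> exists c, i.2.1.1 = a0 ++ c /\ i.2.2 = b0 ++ c.
  move=> /lt; rewrite /degree tE => /common_root[a1 [b1 [c [c' [u1 -> -> aE1 bE1]]]]].
  have [<- <-] : a0 = a1 /\ b0 = b1; last by exists c.
  by apply: unlinked_inj => //; rewrite aE1 bE1 !fg_word_cat invgM !mulgA mulgK.
suff [n [y [ny ->]]] : exists n y, dspan n y /\ lval l = sl s a0 (sr s' b0 y).
  exact: rep_corner_inj ny.
elim: l mE {lt} => [|i l1 IHl] mE.
  by exists 0%N, 0; split; [apply: diag_span0|rewrite sr0 sl0 /lcomb_val big_nil].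
have [|n [y [ny yE]]] := IHl; first by move=> j jl; apply: mE; rewrite in_cons jl orbT.
have [c [iaE ibE]] := mE i (mem_head _ _).
pose d := lmono c (val i.2.1.2) c; pose N := maxn n (size c).+1.
exists N, (i.1 *: d + y); split.
  apply: diag_spanD; last by apply: diag_span_le ny; apply: leq_maxl.
  apply/diag_spanZ/diag_span_mono; first by left; apply: set_valP.
  exact: leq_maxr.
rewrite /lcomb_val big_cons srD srZ slD slZ -yE; congr (_ *: _ + _).
by rewrite iaE ibE /mono sl_cat sr_cat [sl s c (sr _ b0 _)]sl_sr.
Qed.

(** The terms of degree [t] have their image at the coefficient [t], so that the
    kernel contains the homogeneous components of its elements. *)
Lemma phi0_inj x : phi0 x = 0 -> x = 0.
Proof.
have [l ->] := leavitt_span x; pose T := undup [seq degree i | i <- l].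
pose lt t : lcomb R G := [seq i <- l | degree i == t].
have lE : lval l = \sum_(t <- T) lval (lt t).
  rewrite /lcomb_val; under [RHS]eq_bigr do rewrite big_filter.
  rewrite (exchange_big_dep predT) //= [LHS]big_seq [RHS]big_seq.
  apply: eq_bigr => i il; rewrite [RHS]big_mkcond (bigD1_seq (degree i)) ?undup_uniq //=.
    by rewrite eqxx big1 ?addr0 // => t /negbTE; rewrite eq_sym => ->.
  by rewrite /T mem_undup map_f.
have termE i : phi0 (i.1 *: lmono i.2.1.1 (val i.2.1.2) i.2.2) = delta (degree i)
    (i.1 *: (\1_(Xposset i.2.1.1 (val i.2.1.2)) * \1_(Xfg (degree i)) : fct)).
  by rewrite phi0Z phi0_mono ?deltaZ //; left; apply: set_valP.
move=> l0; rewrite lE big1 // => t _.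
apply: (@rep_homogeneous_inj t); first by move=> i; rewrite mem_filter => /andP[/eqP].
apply: phi0_eq0; apply/funext => u; apply/funext => z.
have [->|ut] := eqVneq u t.
  rewrite -[RHS]/((0 : M) t z) -l0 /lcomb_val !phi0_sum big_filter !fct_sumE.
  rewrite [LHS]big_mkcond; apply: eq_bigr => i _; rewrite termE /delta [t == _]eq_sym.
  by case: (degree i == t).
rewrite /lcomb_val phi0_sum big_filter !fct_sumE big1 // => i /eqP it.
by rewrite termE it /delta (negbTE ut).
Qed.

End Injectivity.

Section Isomorphism.
Variables (R : comPzRingType) (G : ultragraph).

Definition phi (x : leavitt R G) : pskew R G := PSkew (mem_set (pskew_set_phi0 x)).

Lemma phi_linear : linear phi.
Proof. by move=> k x y; apply: val_inj; rewrite /= phi0D phi0Z. Qed.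

HB.instance Definition _ :=
  GRing.isLinear.Build R (leavitt R G) (pskew R G) *:%R phi phi_linear.

Lemma phi_bij : bijective phi.
Proof.
have /choice[f fP] : forall m : pskew R G, exists x, phi x = m.
  move=> [m Sm]; have [x xE] := phi0_surj (set_mem Sm).
  by exists x; apply: val_inj.
exists f => // x; apply/eqP; rewrite -subr_eq0; apply/eqP/phi0_inj.
have /(congr1 (@pskew_val R G)) := fP (phi x).
by rewrite -scaleN1r phi0D phi0Z /= => ->; rewrite scaleN1r subrr.
Qed.

End Isomorphism.

Theorem theorem3p10 (R : comPzRingType) (G : ultragraph) :
  exists phi : {linear leavitt R G -> pskew R G},
    [/\ bijective phi,
        forall x y : leavitt R G, pskew_val (phi (x ** y)) =
          pskew_mul (pskew_val (phi x)) (pskew_val (phi y)),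
        forall A : gvset G,
          pskew_val (phi (lpa_p R G A)) = delta 1%g \1_(Xset (val A)),
        forall e : edge G, pskew_val (phi (lpa_s' R G e)) =
          delta (fg_gen e)^-1%g \1_(Xfg (fg_gen e)^-1%g)
      & forall e : edge G, pskew_val (phi (lpa_s R G e)) =
          delta (fg_gen e) \1_(Xfg (fg_gen e))].
Proof.
exists (@phi R G : {linear leavitt R G -> pskew R G}); split.
- exact: phi_bij.
- exact: phi0_mul.
- by move=> A; rewrite /= /phi0 rep_lclass /= restrict_delta mulr1.
- by move=> e; rewrite /= /phi0 rep_lclass /= transport_unit.
- by move=> e; rewrite /= /phi0 rep_lclass /= transport_unit.
Qed.
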